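(* Let $G_1$, $G_2$ be free-by-cyclic groups with a common cyclic subgroup $G_0$ that is a proper subgroup of each $G_i$, $i=1,2$. Then the amalgamated free product $G=G_1*_{G_0} G_2$ is free-by-cyclic if and only if $|G_0|=\infty$ and $G_0\cap[G_i,G_i]=\{1\}$ in $G_i$, for each $i=1,2$.
   Context: A group is called free-by-cyclic if it is isomorphic to a semidirect product $F\rtimes\mathbb{Z}$, where $F$ is a free group of finite rank. *)

(* Defs.v *)
From HB Require Import structures.
From mathcomp Require Import all_boot ssralg ssrint.
From mathcomp Require Import boolp classical_sets cardinality.

Set Implicit Arguments.
Unset Strict Implicit.
Unset Printing Implicit Defensive.

Import GRing.Theory.

Local Open Scope classical_set_scope.
Local Open Scope group_scope.

(* Arbitrary (possibly infinite) groups are [groupType]s, and homomorphisms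
   are terms of [{multiplicative G -> H}]: between groups, compatibility with
   1 and inverses is automatic. *)

Definition isomorphic (G H : groupType) : Prop :=
  exists f : {multiplicative G -> H}, bijective f.

Definition subgroup (G : groupType) (A : set G) : Prop :=
  [/\ A 1, forall x y, A x -> A y -> A (x * y) & forall x, A x -> A x^-1].

Definition generated (G : groupType) (X : set G) : set G :=
  smallest (@subgroup G) X.

Definition is_cyclic (G : groupType) : Prop :=
  exists g : G, generated [set g] = setT.

(* [G, G]: the subgroup generated by the commutators, not just their set. *)
Definition commutator_subgroup (G : groupType) : set G :=
  generated [set [~ p.1, p.2] | p in [set: G * G]].
Arguments commutator_subgroup G : clear implicits.

(* Rank 0, i.e. the trivial group, is allowed. *)
Definition free_basis (F : groupType) (n : nat) (b : 'I_n -> F) : Prop :=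
  forall (H : groupType) (h : 'I_n -> H),
    exists f : {multiplicative F -> H},
      (forall i, f (b i) = h i) /\
      forall f' : {multiplicative F -> H}, (forall i, f' (b i) = h i) -> f' =1 f.

Definition free_of_finite_rank (F : groupType) : Prop :=
  exists (n : nat) (b : 'I_n -> F), free_basis b.

(* An action of H on N by automorphisms, i.e. a homomorphism H -> Aut(N);
   each [gact a] is invertible, with inverse [gact a^-1]. *)
Record group_action (H N : groupType) := GroupAction {
  gact :> H -> N -> N;
  gact1 : forall x, gact 1 x = x;
  gactM : forall a b x, gact (a * b) x = gact a (gact b x);
  gact_morph : forall a x y, gact a (x * y) = gact a x * gact a y
}.

(* The external semidirect product of N and H along phi, on the carrier
   N * H; the alias hides the direct product structure on pairs. *)
Definition sdprod (H N : groupType) (phi : group_action H N) : Type :=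
  (N * H)%type.

Section SemidirectProduct.
Variables (H N : groupType) (phi : group_action H N).

HB.instance Definition _ := Choice.copy (sdprod phi) (N * H)%type.

Definition sd_mul (u v : sdprod phi) : sdprod phi :=
  (u.1 * phi u.2 v.1, u.2 * v.2).
Definition sd_one : sdprod phi := (1, 1).
Definition sd_inv (u : sdprod phi) : sdprod phi := (phi u.2^-1 u.1^-1, u.2^-1).

Fact sd_mulA : associative sd_mul.
Proof. by move=> u v w; rewrite /sd_mul /= gact_morph gactM !mulgA. Qed.

Fact gact_one a : phi a 1 = 1.
Proof. by apply: (@mulgI _ (phi a 1)); rewrite -gact_morph !mulg1. Qed.

Fact sd_mul1 : left_id sd_one sd_mul.
Proof. by move=> [x a]; rewrite /sd_mul /= gact1 !mul1g. Qed.

Fact sd_mul1r : right_id sd_one sd_mul.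
Proof. by move=> [x a]; rewrite /sd_mul /= gact_one !mulg1. Qed.

Fact sd_mulV : left_inverse sd_one sd_inv sd_mul.
Proof.
by move=> [x a]; rewrite /sd_mul /= -gact_morph !mulVg gact_one.
Qed.

Fact sd_mulVr : right_inverse sd_one sd_inv sd_mul.
Proof.
by move=> [x a]; rewrite /sd_mul /= -gactM !mulgV gact1 mulgV.
Qed.

HB.instance Definition _ :=
  isGroup.Build (sdprod phi) sd_mulA sd_mul1 sd_mul1r sd_mulV sd_mulVr.

End SemidirectProduct.

(* The additive group of the integers, as a multiplicative [groupType]. *)
Definition Zgroup : Type := int.
HB.instance Definition _ := Choice.copy Zgroup int.
HB.instance Definition _ :=
  isGroup.Build Zgroup (@addrA int) (@add0r int) (@addr0 int)
    (@addNr int) (@addrN int).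

Definition free_by_cyclic (G : groupType) : Prop :=
  exists F : groupType, free_of_finite_rank F /\
    exists phi : group_action Zgroup F, isomorphic G (sdprod phi).

(* G, with the maps j1 and j2, is the amalgamated free product of G1 and G2
   along f1 : G0 -> G1 and f2 : G0 -> G2, i.e. their pushout. *)
Definition is_amalgam (G0 G1 G2 G : groupType)
    (f1 : {multiplicative G0 -> G1}) (f2 : {multiplicative G0 -> G2})
    (j1 : {multiplicative G1 -> G}) (j2 : {multiplicative G2 -> G}) : Prop :=
  (forall x, j1 (f1 x) = j2 (f2 x)) /\
  forall (H : groupType)
    (h1 : {multiplicative G1 -> H}) (h2 : {multiplicative G2 -> H}),
    (forall x, h1 (f1 x) = h2 (f2 x)) ->
    exists u : {multiplicative G -> H},
      [/\ forall x, u (j1 x) = h1 x, forall y, u (j2 y) = h2 y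
        & forall u' : {multiplicative G -> H},
            (forall x, u' (j1 x) = h1 x) -> (forall y, u' (j2 y) = h2 y) ->
            u' =1 u].

(* Main.v *)
(* Let [psi : G -> Z] be a character with finitely generated kernel. If [psi]
   vanished on [G0], the kernel would move the base edge of the Bass-Serre tree
   only over boundedly many levels of [psi], although the kernel is normal and
   [G] moves levels arbitrarily far; hence [psi] is injective on [G0], and
   [G0] meets the commutator subgroups trivially.

   Conversely, linear algebra on the abelianization gives characters of [G1] and
   [G2] that do not vanish on [G0] and lie close to the given fibrations, and
   after scaling they agree on [G0]. It remains to see that the kernel of the
   resulting character [psi] of [G] is free of finite rank. It is finitely
   generated by Schreier's argument. To see that it is free it suffices to embed
   it in a free group, by the Nielsen-Schreier theorem. For this, call [psi]
   liftable if for every surjection [A' -> A] each homomorphism [G -> A],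
   viewed as a cocycle for the action of [G] on [Z] through [psi], lifts to a
   cocycle with values in [A']. Liftability passes to amalgams over a subgroup
   on which [psi] is injective, holds for characters close to a fibration, and,
   applied to a surjection from a free group onto [G], gives a section of that
   surjection over the kernel. *)

Require Import Defs.
From HB Require Import structures.
From mathcomp Require Import all_boot order ssralg ssrint ssrnum.
From mathcomp Require Import rat matrix mxalgebra intdiv.
From mathcomp Require Import boolp classical_sets cardinality.
From mathcomp Require Import zify.

Set Implicit Arguments.
Unset Strict Implicit.
Unset Printing Implicit Defensive.

Import Order.TTheory GRing.Theory Num.Theory.

Local Open Scope classical_set_scope.
Local Open Scope group_scope.

(** * Homomorphisms, integer powers, integer characters and generated subgroups *)

Section Morphisms.
Variables (G H : groupType).

Definition mkhom (f : G -> H) (fM : {morph f : x y / x * y}) :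
  {multiplicative G -> H} := HB.pack f (isMultiplicative.Build G H f fM).

Variable f : {multiplicative G -> H}.

Lemma homM x y : f (x * y) = f x * f y.
Proof. exact: gmulfM. Qed.

Lemma hom1 : f 1 = 1.
Proof. by apply: (@mulgI _ (f 1)); rewrite -homM !mulg1. Qed.

Lemma homV x : f x^-1 = (f x)^-1.
Proof. by apply: (@mulgI _ (f x)); rewrite -homM !mulgV hom1. Qed.

End Morphisms.

Definition comp_hom (G H K : groupType) (g : {multiplicative H -> K})
  (f : {multiplicative G -> H}) : {multiplicative G -> K} := (g \o f).

Definition triv_hom (G H : groupType) : {multiplicative G -> H} :=
  mkhom (f := fun=> 1) (fun _ _ => esym (mulg1 1)).

Section IntegerPowers.
Variable G : groupType.
Implicit Types (g : G) (m n : int).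

Definition zpow g m : G :=
  match m with Posz n => g ^+ n | Negz n => (g ^+ n.+1)^-1 end.

Lemma zpow1 g : zpow g (1 : int) = g. Proof. exact: expg1. Qed.

Lemma zpow0 g : zpow g (0 : int) = 1. Proof. by []. Qed.

Lemma zpow_succ g m : zpow g (1 + m)%R = g * zpow g m.
Proof.
case: m => [n|[|n]]; first by rewrite -PoszD add1n /= expgS.
  by rewrite (_ : (1 + Negz 0)%R = 0%Z) ?zpow0 //= expg1 mulgV.
rewrite (_ : (1 + Negz n.+1)%R = Negz n); last lia.
by rewrite /= (expgSr g n.+1) invgM mulVKg.
Qed.

Lemma zpowD g m n : zpow g (m + n)%R = zpow g m * zpow g n.
Proof.
elim/int_rect: m => [|m IH|m IH]; first by rewrite add0r zpow0 mul1g.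
  rewrite (_ : (Posz m.+1 + n)%R = (1 + (Posz m + n))%R); last lia.
  by rewrite zpow_succ IH mulgA -zpow_succ -PoszD.
apply: (@mulgI _ g); rewrite mulgA -!zpow_succ.
rewrite (_ : (1 + (- Posz m.+1 + n))%R = (- Posz m + n)%R); last lia.
by rewrite (_ : (1 + - Posz m.+1)%R = (- Posz m)%R) //; lia.
Qed.

Lemma zpowN g m : zpow g (- m)%R = (zpow g m)^-1.
Proof.
by apply: (@mulgI _ (zpow g m)); rewrite -zpowD addrN zpow0 mulgV.
Qed.

End IntegerPowers.

Lemma hom_zpow (G H : groupType) (f : {multiplicative G -> H}) g m :
  f (zpow g m) = zpow (f g) m.
Proof.
elim/int_rect: m => [|m IH|m IH]; first by rewrite !zpow0 hom1.
  by rewrite -[Posz m.+1]/(1 + Posz m)%R !zpow_succ homM IH.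
apply: (@mulgI _ (f g)); rewrite -homM -!zpow_succ.
by rewrite (_ : (1 + - Posz m.+1)%R = (- Posz m)%R) //; lia.
Qed.

Section IntegerCharacters.
Variables (G : groupType) (psi : {multiplicative G -> Zgroup}).

Definition zchar (g : G) : int := psi g.

Lemma zcharM x y : zchar (x * y) = (zchar x + zchar y)%R.
Proof. by rewrite /zchar homM. Qed.

Lemma zchar1 : zchar 1 = 0%R.
Proof. by rewrite /zchar hom1. Qed.

Lemma zcharV x : zchar x^-1 = (- zchar x)%R.
Proof. by rewrite /zchar homV. Qed.

Lemma zchar_zpow x m : zchar (zpow x m) = (m * zchar x)%R.
Proof.
elim/int_rect: m => [|m IH|m IH]; first by rewrite zchar1 mul0r.
  by rewrite -[Posz m.+1]/(1 + Posz m)%R zpow_succ zcharM IH; lia.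
have E : (- Posz m)%R = (1 + - Posz m.+1)%R by lia.
by move: IH; rewrite {1}E zpow_succ zcharM; lia.
Qed.

End IntegerCharacters.

Definition mkzchar (G : groupType) (f : G -> int)
    (fM : forall x y, f (x * y) = (f x + f y)%R) :
  {multiplicative G -> Zgroup} := mkhom (f := f : G -> Zgroup) fM.

Section Generation.
Variable G : groupType.
Implicit Types (X A : set G).

Lemma subgroup_generated X : subgroup (generated X).
Proof.
split=> [A [[A1 _ _] _] //|x y Xx Xy A [sA XA]|x Xx A [sA XA]].
  by case: (sA) => _ AM _; apply: AM; [apply: Xx|apply: Xy].
by case: (sA) => _ _; apply; apply: Xx.
Qed.

Lemma mem_generated X : X `<=` generated X.
Proof. exact: sub_gen_smallest. Qed.

Lemma generated_sub X A : subgroup A -> X `<=` A -> generated X `<=` A.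
Proof. exact: smallest_sub. Qed.

Lemma generated1 X : generated X 1.
Proof. by case: (subgroup_generated X). Qed.

Lemma generatedM X x y : generated X x -> generated X y -> generated X (x * y).
Proof. by case: (subgroup_generated X) => _ + _; apply. Qed.

Lemma generatedV X x : generated X x -> generated X x^-1.
Proof. by case: (subgroup_generated X) => _ _; apply. Qed.

End Generation.

Lemma subgroup_preim (G H : groupType) (f : {multiplicative G -> H})
  (A : set H) : subgroup A -> subgroup (f @^-1` A).
Proof.
case=> A1 AM AV; split=> [|x y|x]; rewrite /preimage /=.
- by rewrite hom1.
- by rewrite homM; apply: AM.
- by rewrite homV; apply: AV.
Qed.

Lemma subgroup_equal (G H : groupType) (f g : {multiplicative G -> H}) :
  subgroup [set x | f x = g x].
Proof.
split=> [|x y|x] /=; first by rewrite !hom1.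
  by rewrite !homM => -> ->.
by rewrite !homV => ->.
Qed.

(** * Cocycles, permutations and free groups *)

(* Homomorphisms [G -> wreath A S] over [psi : G -> S] are the maps
   [g |-> (c g, psi g)] with [c (g * f) x = c g (psi f * x) * c f x]. *)
Definition wreath (A S : groupType) : Type := ((S -> A) * S)%type.

Section Wreath.
Variables (A S : groupType).
Implicit Types u v w : wreath A S.

HB.instance Definition _ := gen_eqMixin (wreath A S).
HB.instance Definition _ := gen_choiceMixin (wreath A S).

Definition wr_mul u v : wreath A S :=
  (fun x => u.1 (v.2 * x) * v.1 x, u.2 * v.2).
Definition wr_one : wreath A S := (fun=> 1, 1).
Definition wr_inv u : wreath A S := (fun x => (u.1 (u.2^-1 * x))^-1, u.2^-1).

Fact wr_eq u v : u.1 =1 v.1 -> u.2 = v.2 -> u = v.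
Proof. by case: u v => [a s] [b t] /= /funext-> ->. Qed.

Fact wr_mulA : associative wr_mul.
Proof. by move=> u v w; apply: wr_eq => [x|] /=; rewrite !mulgA. Qed.

Fact wr_mul1 : left_id wr_one wr_mul.
Proof. by move=> u; apply: wr_eq => [x|] /=; rewrite mul1g. Qed.

Fact wr_mul1r : right_id wr_one wr_mul.
Proof. by move=> u; apply: wr_eq => [x|] /=; rewrite ?mul1g mulg1. Qed.

Fact wr_mulV : left_inverse wr_one wr_inv wr_mul.
Proof. by move=> u; apply: wr_eq => [x|] /=; rewrite ?mulKg mulVg. Qed.

Fact wr_mulVr : right_inverse wr_one wr_inv wr_mul.
Proof. by move=> u; apply: wr_eq => [x|] /=; rewrite mulgV. Qed.

HB.instance Definition _ :=
  isGroup.Build (wreath A S) wr_mulA wr_mul1 wr_mul1r wr_mulV wr_mulVr.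

Lemma wrM1 u v x : (u * v).1 x = u.1 (v.2 * x) * v.1 x.
Proof. by []. Qed.

Lemma wrM2 u v : (u * v).2 = u.2 * v.2.
Proof. by []. Qed.

Lemma wrV1 u x : (u^-1).1 x = (u.1 (u.2^-1 * x))^-1.
Proof. by []. Qed.

Lemma wrV2 u : (u^-1).2 = u.2^-1.
Proof. by []. Qed.

Definition wr_snd : {multiplicative wreath A S -> S} :=
  mkhom (f := fun u : wreath A S => u.2) wrM2.

Lemma wr_zpow2 u k : (zpow u k).2 = zpow u.2 k.
Proof. exact: (hom_zpow wr_snd). Qed.

Variable G : groupType.

Definition const_hom (u : {multiplicative G -> A})
    (psi : {multiplicative G -> S}) : {multiplicative G -> wreath A S}.
Proof.
apply: (@mkhom _ _ (fun g => (fun=> u g, psi g) : wreath A S)).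
by move=> x y; apply: wr_eq => [z|] /=; rewrite homM.
Defined.

(** Conjugation by the element [(m, 1)] of the wreath product: the cocycle changes by the coboundary
    of [m]. *)
Definition twist_hom (m : S -> A) (h : {multiplicative G -> wreath A S}) :
  {multiplicative G -> wreath A S}.
Proof.
apply: (@mkhom _ _ (fun g =>
  (fun x => m ((h g).2 * x) * (h g).1 x * (m x)^-1, (h g).2) : wreath A S)).
by move=> x y; apply: wr_eq => [z|] /=; rewrite homM //= !gnorm.
Defined.

End Wreath.

(* With [m] the indicator function of [A], the cocycle [m (g * x) / m x] is
   trivial exactly when [g] is in [A]. *)
Lemma subgroup_equalizer (G : groupType) (A : set G) : subgroup A ->
  exists (H : groupType) (h h' : {multiplicative G -> H}),
    A = [set x | h x = h' x].
Proof.
case=> A1 AM AV; pose m x : Zgroup := if `[< A x >] then 1%Z else 0%Z.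
have mE x y : m (x * y) = m y -> A y -> A x.
  rewrite /m; case: asboolP => Axy; case: asboolP => Ay // _ _.
  by rewrite -[x](mulgK y); apply: AM => //; apply: AV.
pose h := const_hom (triv_hom G Zgroup) (idfun : {multiplicative G -> G}).
exists (wreath Zgroup G), h, (twist_hom m h); apply/seteqP; split=> x /=.
  move=> Ax; apply: wr_eq => //= y; rewrite mulg1.
  suff -> : m (x * y) = m y by rewrite mulgV.
  rewrite /m (_ : A (x * y) = A y) //; apply/propext; split; last exact: AM.
  by move=> Axy; rewrite -[y](mulKg x); apply: AM => //; apply: AV.
move=> E; apply: (@mE x 1) => //.
have := congr1 (fun w : wreath Zgroup G => w.1 1) E => /=.
by rewrite mulg1 => /esym/divg1_eq.
Qed.

(** [free_basis] with an arbitrary index type, as needed for the free group on the underlying set of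
    a group and for Schreier bases. *)
Definition free_on (I : Type) (F : groupType) (b : I -> F) : Prop :=
  forall (H : groupType) (h : I -> H),
    exists f : {multiplicative F -> H},
      (forall i, f (b i) = h i) /\
      forall f' : {multiplicative F -> H}, (forall i, f' (b i) = h i) -> f' =1 f.

Section FreeOn.
Variables (I : Type) (F : groupType) (b : I -> F).
Hypothesis Fb : free_on b.

Lemma free_hom (H : groupType) (h : I -> H) :
  {f : {multiplicative F -> H} | forall i, f (b i) = h i}.
Proof. by apply: cid; have [f [fb _]] := Fb h; exists f. Qed.

Lemma free_ext (H : groupType) (f f' : {multiplicative F -> H}) :
  (forall i, f (b i) = f' (b i)) -> f =1 f'.
Proof.
move=> E; have [g [_ gU]] := Fb (fun i => f' (b i)).
by move=> x; rewrite (gU f) // (gU f').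
Qed.

(** A subgroup is the equalizer of two homomorphisms, so uniqueness in the universal property acts
    as an induction principle. *)
Lemma free_ind (A : set F) : subgroup A -> (forall i, A (b i)) -> forall x, A x.
Proof.
move=> /subgroup_equalizer[H [h [h' ->]]] Ab x; exact: free_ext.
Qed.

End FreeOn.

Section FreeGroup.
Variable I : Type.
Local Notation word := (seq (I * bool)).

Definition eval_letter (H : groupType) (h : I -> H) (l : I * bool) : H :=
  if l.2 then h l.1 else (h l.1)^-1.
Definition eval_word (H : groupType) (h : I -> H) (w : word) : H :=
  foldr (fun l => mul (eval_letter h l)) 1 w.

Lemma eval_cat (H : groupType) (h : I -> H) v w :
  eval_word h (v ++ w) = eval_word h v * eval_word h w.
Proof. by elim: v => [|l v IH] /=; rewrite ?mul1g // IH mulgA. Qed.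

Definition inv_word (w : word) : word := rev [seq (l.1, ~~ l.2) | l <- w].

Lemma eval_inv (H : groupType) (h : I -> H) w :
  eval_word h (inv_word w) = (eval_word h w)^-1.
Proof.
elim: w => [|[i e] w IH] /=; first by rewrite invg1.
rewrite /inv_word /= rev_cons -cats1 eval_cat invgM -IH /=; congr (_ * _).
by rewrite mulg1 /eval_letter /=; case: e; rewrite ?invgK.
Qed.

(* The free group is the set of chosen representatives of the words modulo
   equality of their values in all groups; no reduction of words is needed. *)
Definition same_word (v w : word) : Prop :=
  forall (H : groupType) (h : I -> H), eval_word h v = eval_word h w.

Definition nf_word (w : word) : word :=
  xget (w : {classic word}) (same_word w).

Lemma nf_wordE (H : groupType) (h : I -> H) w :
  eval_word h (nf_word w) = eval_word h w.
Proof.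
suff : same_word w (nf_word w) by move=> ->.
by apply: (@xgetPex {classic word}); exists w.
Qed.

Lemma nf_word_eq v w : same_word v w -> nf_word v = nf_word w.
Proof.
move=> vw; rewrite /nf_word.
have -> : same_word v = same_word w :> set {classic word}.
  by apply/seteqP; split=> u E H h; rewrite -E ?vw // -vw.
rewrite /xget; case: pselect => // nex; case: nex.
by exists w; apply/asboolP.
Qed.

Definition free_group : Type := {w : word | nf_word w = w}.
HB.instance Definition _ := gen_eqMixin free_group.
HB.instance Definition _ := gen_choiceMixin free_group.

Definition of_word (w : word) : free_group :=
  exist _ (nf_word w) (nf_word_eq (fun H h => nf_wordE h w)).

Fact fg_eq (x y : free_group) :
  (forall (H : groupType) (h : I -> H),
    eval_word h (sval x) = eval_word h (sval y)) -> x = y.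
Proof.
case: x y => [v vE] [w wE] /= vw.
have E : v = w by rewrite -vE -wE; apply: nf_word_eq.
by case: w / E vw wE => _ wE; rewrite (Prop_irrelevance vE wE).
Qed.

Definition fg_mul (x y : free_group) := of_word (sval x ++ sval y).
Definition fg_one := of_word [::].
Definition fg_inv (x : free_group) := of_word (inv_word (sval x)).

Fact fg_mulA : associative fg_mul.
Proof.
by move=> x y z; apply: fg_eq => H h; rewrite !(nf_wordE, eval_cat) mulgA.
Qed.
Fact fg_mul1 : left_id fg_one fg_mul.
Proof. by move=> x; apply: fg_eq => H h; rewrite !(nf_wordE, eval_cat) mul1g. Qed.
Fact fg_mul1r : right_id fg_one fg_mul.
Proof. by move=> x; apply: fg_eq => H h; rewrite !(nf_wordE, eval_cat) mulg1. Qed.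
Fact fg_mulV : left_inverse fg_one fg_inv fg_mul.
Proof.
by move=> x; apply: fg_eq => H h; rewrite !(nf_wordE, eval_cat, eval_inv) mulVg.
Qed.
Fact fg_mulVr : right_inverse fg_one fg_inv fg_mul.
Proof.
by move=> x; apply: fg_eq => H h; rewrite !(nf_wordE, eval_cat, eval_inv) mulgV.
Qed.

HB.instance Definition _ :=
  isGroup.Build free_group fg_mulA fg_mul1 fg_mul1r fg_mulV fg_mulVr.

Definition fg_gen (i : I) : free_group := of_word [:: (i, true)].

Lemma free_group_free : free_on fg_gen.
Proof.
move=> H h.
have fM : {morph (fun x : free_group => eval_word h (sval x)) : x y / x * y}.
  by move=> x y; rewrite /= nf_wordE eval_cat.
exists (mkhom fM); split=> [i|f' f'E x] /=.
  by rewrite nf_wordE /= mulg1.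
have of_wordE w : f' (of_word w) = eval_word h w.
  elim: w => [|[i e] w IH].
    by rewrite -[RHS](hom1 f'); congr (f' _); apply: fg_eq.
  have -> : of_word ((i, e) :: w) = eval_letter fg_gen (i, e) * of_word w.
    apply: fg_eq => H' h'; rewrite !(nf_wordE, eval_cat).
    by case: e; rewrite /= /eval_letter /= ?nf_wordE ?eval_inv ?nf_wordE /= mulg1.
  by rewrite homM IH /=; congr (_ * _); case: e; rewrite /eval_letter /= ?homV f'E.
rewrite -of_wordE; congr (f' _); apply: fg_eq => H' h'.
by rewrite nf_wordE.
Qed.

End FreeGroup.

Record permutation (T : Type) := Permutation {
  perm_fun :> T -> T;
  perm_inv : T -> T;
  perm_funK : cancel perm_fun perm_inv;
  perm_invK : cancel perm_inv perm_fun
}.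

Section Permutations.
Variable T : Type.
Implicit Types s t u : permutation T.

HB.instance Definition _ := gen_eqMixin (permutation T).
HB.instance Definition _ := gen_choiceMixin (permutation T).

Fact permutation_eq s t : s =1 t -> s = t.
Proof.
case: s t => [f f' fK f'K] [g g' gK g'K] /= /funext fg.
case: g / fg gK g'K => gK g'K.
have E : f' = g' by apply/funext => x; rewrite -[in LHS](g'K x) fK.
case: g' / E gK g'K => gK g'K.
by rewrite (Prop_irrelevance gK fK) (Prop_irrelevance g'K f'K).
Qed.

Definition pm_one : permutation T :=
  @Permutation T id id (fun=> erefl) (fun=> erefl).
Definition pm_mul s t : permutation T :=
  Permutation (can_comp (@perm_funK _ s) (@perm_funK _ t))
              (can_comp (@perm_invK _ t) (@perm_invK _ s)).
Definition pm_inv s : permutation T :=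
  Permutation (@perm_invK _ s) (@perm_funK _ s).

Fact pm_mulA : associative pm_mul.
Proof. by move=> s t u; apply: permutation_eq. Qed.
Fact pm_mul1 : left_id pm_one pm_mul.
Proof. by move=> s; apply: permutation_eq. Qed.
Fact pm_mul1r : right_id pm_one pm_mul.
Proof. by move=> s; apply: permutation_eq. Qed.
Fact pm_mulV : left_inverse pm_one pm_inv pm_mul.
Proof. by move=> s; apply: permutation_eq => x /=; rewrite perm_funK. Qed.
Fact pm_mulVr : right_inverse pm_one pm_inv pm_mul.
Proof. by move=> s; apply: permutation_eq => x /=; rewrite perm_invK. Qed.

HB.instance Definition _ :=
  isGroup.Build (permutation T) pm_mulA pm_mul1 pm_mul1r pm_mulV pm_mulVr.

Lemma perm_rep (G : groupType) (a : G -> T -> T) :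
  a 1 =1 id -> (forall x y p, a (x * y) p = a x (a y p)) ->
  {f : {multiplicative G -> permutation T} | forall x, f x =1 a x}.
Proof.
move=> a1 aM.
have aK x : cancel (a x) (a x^-1) by move=> p; rewrite -aM mulVg a1.
have aVK x : cancel (a x^-1) (a x) by move=> p; rewrite -aM mulgV a1.
pose f x := Permutation (aK x) (aVK x).
have fM : {morph f : x y / x * y}.
  by move=> x y; apply: permutation_eq => p /=; rewrite aM.
by exists (mkhom fM).
Qed.

End Permutations.

(** * Amalgamated products *)

(** Choose a representative in each coset of the image of [f]; [rho] reads off the [G0]-coordinate
    relative to it. *)
Lemma equivariant_retraction (G0 G1 : groupType) (f : {multiplicative G0 -> G1}) :
  injective f -> exists rho : G1 -> G0, forall z x, rho (f z * x) = z * rho x.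
Proof.
move=> f_inj; pose rep x := xget 1 [set y : G1 | exists z, y = f z * x].
have repP x : exists z, x = f z * rep x.
  have [|z E] := @xgetPex _ 1 [set y : G1 | exists z, y = f z * x].
    by exists x, 1; rewrite hom1 mul1g.
  by exists z^-1; rewrite /rep E mulgA -homM mulVg hom1 mul1g.
have repM z x : rep (f z * x) = rep x.
  congr xget; apply/seteqP; split=> y [t ->].
    by exists (t * z); rewrite homM mulgA.
  by exists (t * z^-1); rewrite homM homV mulgA mulgVK.
have [rho rhoE] := choice repP.
exists rho => z x; apply: f_inj; rewrite homM.
by apply: (@mulIg _ (rep x)); rewrite -mulgA -rhoE -{1}(repM z) -rhoE.
Qed.

Section Amalgam.
Variables (G0 G1 G2 G : groupType).
Variables (f1 : {multiplicative G0 -> G1}) (f2 : {multiplicative G0 -> G2}).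
Variables (j1 : {multiplicative G1 -> G}) (j2 : {multiplicative G2 -> G}).
Hypothesis GA : is_amalgam f1 f2 j1 j2.

Lemma amalgam_ind (A : set G) : subgroup A ->
  (forall x, A (j1 x)) -> (forall y, A (j2 y)) -> forall g, A g.
Proof.
move=> /subgroup_equalizer[H [h [h' ->]]] /= A1 A2 g.
have [//= x|u [_ _ uU]] := GA.2 H (comp_hom h j1) (comp_hom h j2).
  by rewrite GA.1.
by rewrite (uU h) // (uU h') => // x /=; rewrite ?A1 ?A2.
Qed.

Lemma amalgam_sym : is_amalgam f2 f1 j2 j1.
Proof.
split=> [x|H h2 h1 E]; first by rewrite GA.1.
have [x|u [u1 u2 uU]] := GA.2 H h1 h2; first by rewrite E.
by exists u; split=> // u' E2 E1; apply: uU.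
Qed.

(* [G1] and [G2] act on [G1 * G2], each by translation of its own factor; the
   induced translation of the other factor is chosen so that [G0] acts
   diagonally. *)
Lemma amalgam_inj : injective f1 -> injective f2 -> injective j2.
Proof.
move=> /equivariant_retraction[r1 r1E] /equivariant_retraction[r2 r2E].
pose a1 (g : G1) (x : G1 * G2) := (g * x.1, f2 (r1 (g * x.1) * (r1 x.1)^-1) * x.2).
pose a2 (g : G2) (x : G1 * G2) := (f1 (r2 (g * x.2) * (r2 x.2)^-1) * x.1, g * x.2).
have a11 : a1 1 =1 id by case=> x y; rewrite /a1 /= mul1g mulgV hom1 mul1g.
have a21 : a2 1 =1 id by case=> x y; rewrite /a2 /= mul1g mulgV hom1 mul1g.
have a1M g h x : a1 (g * h) x = a1 g (a1 h x).
  by rewrite /a1 /= !mulgA -homM !mulgA mulgVK.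
have a2M g h x : a2 (g * h) x = a2 g (a2 h x).
  by rewrite /a2 /= !mulgA -homM !mulgA mulgVK.
have [p1 p1E] := perm_rep a11 a1M; have [p2 p2E] := perm_rep a21 a2M.
have [z|u [_ u2 _]] := GA.2 _ p1 p2.
  apply: permutation_eq => -[x y].
  by rewrite p1E p2E /a1 /a2 /= r1E r2E !mulgK.
move=> y y' /(congr1 u); rewrite !u2.
move=> /(congr1 (fun s : permutation _ => s (1, 1))).
by rewrite !p2E => -[_]; rewrite !mulg1.
Qed.

End Amalgam.

Definition fg_ker (G : groupType) (psi : {multiplicative G -> Zgroup}) : Prop :=
  exists s : seq G, (forall x, x \in s -> zchar psi x = 0%R) /\
    forall g, zchar psi g = 0%R -> generated [set` s] g.

Section EdgeGroup.
Variables (G0 G1 G2 G : groupType).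
Variables (f1 : {multiplicative G0 -> G1}) (f2 : {multiplicative G0 -> G2}).
Variables (j1 : {multiplicative G1 -> G}) (j2 : {multiplicative G2 -> G}).
Hypothesis GA : is_amalgam f1 f2 j1 j2.

(* The cocycle below counts, with signs, the translates of the base edge of the
   Bass-Serre tree on the path from [v] to [g v], where [v] is the vertex fixed
   by [G1]. If [G0] were in the kernel of [xi], the edges met by a finitely
   generated kernel would lie in finitely many levels. *)
Lemma edge_group_escapes_kernel (xi : {multiplicative G -> Zgroup}) :
    injective f1 -> injective f2 -> fg_ker xi ->
    (exists u, zchar xi (j1 u) <> 0%R) -> (exists y, ~ range f2 y) ->
  exists z, zchar xi (j1 (f1 z)) <> 0%R.
Proof.
move=> f1I f2I [s [sker0 sker]] [u ua] [y yG0].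
apply: contrapT => /forallNP xiG0.
have {}xiG0 z : zchar xi (j1 (f1 z)) = 0%R by apply: contrapT; apply: xiG0.
pose edge := range (j1 \o f1).
pose m x : Zgroup := if `[< edge x >] then 1%Z else 0%Z.
have edge_xi x : edge x -> zchar xi x = 0%R by case=> z _ <-; apply: xiG0.
(* This invariance makes the coboundary of [m] trivial on [G0], so that [h1] and [h2] below agree
   there. *)
have mM z x : m (j2 (f2 z) * x) = m x.
  rewrite /m (_ : edge _ = edge x) // -GA.1; apply/propext; split=> -[t _ /= E].
    exists (z^-1 * t) => //=.
    by rewrite homM homM E !homV mulKg.
  by exists (z * t) => //=; rewrite homM homM E.
have m0 x : ~ edge x -> m x = 1 by rewrite /m; case: asboolP.
pose h1 := const_hom (triv_hom G1 Zgroup) j1.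
pose h2 := twist_hom m (const_hom (triv_hom G2 Zgroup) j2).
have [z|v [v1 v2 _]] := GA.2 _ h1 h2.
  by apply: wr_eq => [x|] /=; rewrite ?GA.1 // mM mulg1 mulgV.
have vE g : (v g).2 = g.
  move: g; apply: (amalgam_ind GA (A := [set g | (v g).2 = g])) => [|x|x] /=.
  - split=> [|x1 x2|x1] /=; first by rewrite hom1.
      by rewrite homM wrM2 => -> ->.
    by rewrite homV wrV2 => ->.
  - by rewrite v1.
  - by rewrite v2.
pose c g x := (v g).1 x.
have cM g h x : c (g * h) x = c g (h * x) * c h x.
  by rewrite /c homM wrM1 vE.
have cV g x : c g^-1 x = (c g (g^-1 * x))^-1.
  by rewrite /c homV wrV1 vE.
have c1 g x : c (j1 g) x = 1 by rewrite /c v1.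
have c2 g x : c (j2 g) x = m (j2 g * x) * (m x)^-1.
  by rewrite /c v2 /= mulg1.
(* Each cocycle [c g] lives in finitely many levels of [xi], because [m] lives in level 0. *)
have bnd g : exists N : nat, forall x, (N < `|zchar xi x|)%N -> c g x = 1.
  move: g; apply: (amalgam_ind GA
    (A := [set g | exists N : nat, forall x, (N < `|zchar xi x|)%N -> c g x = 1])).
  - split=> [|a b [N cN] [M cM']|a [N cN]] /=.
    + by exists 0%N => x _; rewrite /c hom1.
    + exists (N + M + `|zchar xi b|)%N => x lx.
      by rewrite cM cN ?cM' ?mulg1 // ?zcharM; lia.
    + exists (N + `|zchar xi a|)%N => x lx.
      by rewrite cV cN ?invg1 // zcharM zcharV; lia.
  - by move=> x; exists 0%N => x0 _; rewrite c1.
  - move=> x; exists `|zchar xi (j2 x)|%N => x0 lx; rewrite c2.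
    rewrite !m0 ?mulgV // => /edge_xi; rewrite ?zcharM; lia.
have [N cN] : exists N : nat,
    forall g x, g \in s -> (N < `|zchar xi x|)%N -> c g x = 1.
  elim: {sker0 sker} s => [|g s [N IH]]; first by exists 0%N.
  have [M cM'] := bnd g; exists (N + M)%N => g' x; rewrite inE => /orP[/eqP->|].
    by move=> lx; apply: cM'; lia.
  by move=> g's lx; apply: IH => //; lia.
(* A commutator, hence in the kernel of [xi]. Written additively, its cocycle at [j1 u] is
   [- m (j1 u * (j2 y)^-1) - m 1], which is -1 or -2. *)
pose f := j2 y * j1 u * (j2 y)^-1 * (j1 u)^-1.
have xif : zchar xi f = 0%R by rewrite !(zcharM, zcharV); lia.
have cf : c f (j1 u) <> 1.
  rewrite /f !cM !cV !c1 invg1 mulg1 !c2 !gnorm.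
  rewrite (@m0 (j2 y * j1 u * (j2 y)^-1)); last first.
    by move/edge_xi; rewrite !(zcharM, zcharV); lia.
  rewrite (@m0 (j2 y)^-1); last first.
    case=> z _ /= E; apply: yG0; exists z^-1 => //.
    apply: (amalgam_inj GA f1I f2I); rewrite -GA.1 !homV E invgK //.
  have -> : m 1 = 1%Z.
    by rewrite /m; case: asboolP => // -[]; exists 1 => //=; rewrite !hom1.
  by rewrite /m; case: asboolP => _ /eqP.
(* Conjugation by [w] carries this nontrivial value to level [(N + 1) * xi (j1 u)], beyond the bound
   [N]. *)
pose w := j1 (zpow u (Posz N)).
apply: cf; have <- : c (w * f * w^-1) (w * j1 u) = c f (j1 u).
  rewrite cM [c (w * f) _]cM [c w^-1 _]cV [c w _]c1 [c w _]c1.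
  by rewrite invg1 mulg1 mul1g mulKg.
(* Elements of the kernel preserve levels, so products of the generators keep the bound [N] without
   enlarging it. *)
have ker_bnd g : generated [set` s] g -> zchar xi g = 0%R /\
    forall x, (N < `|zchar xi x|)%N -> c g x = 1.
  move: g; apply: generated_sub => [|g gs]; last first.
    by split=> [|x]; [apply: sker0|apply: cN].
  split=> [|a b [a0 ca] [b0 cb]|a [a0 ca]].
  - by split=> [|x _]; rewrite ?zchar1 // /c hom1.
  - split=> [|x lx]; first by rewrite zcharM; lia.
    by rewrite cM ca ?cb ?mulg1 // zcharM; lia.
  - split=> [|x lx]; first by rewrite zcharV; lia.
    by rewrite cV ca ?invg1 // zcharM zcharV; lia.
apply: (proj2 (ker_bnd _ _)).
  by apply: sker; rewrite zcharM [zchar xi (w * f)]zcharM zcharV xif; lia.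
by rewrite zcharM /w hom_zpow zchar_zpow; move: ua; nia.
Qed.
End EdgeGroup.

(** * Semidirect products with the integers, and necessity of the conditions *)

Section FreeByCyclic.
Variables (F : groupType) (phi : group_action Zgroup F).

Definition sd_inl (f : F) : sdprod phi := (f, 1).
Definition sd_t : sdprod phi := (1, 1%Z).

Fact sd_inlM : {morph sd_inl : x y / x * y}.
Proof. by move=> x y; rewrite [RHS]/mul /= /sd_mul /= gact1. Qed.

Definition sd_inl_hom : {multiplicative F -> sdprod phi} := mkhom sd_inlM.

Definition sd_snd : {multiplicative sdprod phi -> Zgroup} :=
  mkhom (f := fun x : sdprod phi => x.2) (fun _ _ => erefl).

Lemma sd_tE k : zpow sd_t k = (1, k) :> sdprod phi.
Proof.
have S n : (sd_t * (1, n) : sdprod phi) = (1, (1 + n)%R).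
  by rewrite [LHS]/mul /= /sd_mul /= gact_one mulg1.
elim/int_rect: k => [|k IH|k IH] //.
  by rewrite -[Posz k.+1]/(1 + Posz k)%R zpow_succ IH S.
apply: (@mulgI _ sd_t); rewrite -zpow_succ S.
have -> : (1 + - Posz k.+1)%R = (- Posz k)%R by lia.
by [].
Qed.

Lemma sdE (x : sdprod phi) : x = sd_inl x.1 * zpow sd_t x.2.
Proof.
case: x => f k; rewrite sd_tE [RHS]/mul /= /sd_mul /= gact_one mulg1.
by rewrite mul1g.
Qed.

Lemma sd_relation f : sd_t * sd_inl f = sd_inl (phi 1%Z f) * sd_t.
Proof.
by rewrite [LHS]/mul [RHS]/mul /= /sd_mul /= gact_one mul1g !mulg1 mul1g.
Qed.

(** The relation for the generator of the integers propagates to all its powers, by induction in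
    both directions. *)
Lemma sd_hom (H : groupType) (h : {multiplicative F -> H}) (t : H) :
    (forall f, t * h f = h (phi 1%Z f) * t) ->
  {u : {multiplicative sdprod phi -> H} |
    forall x, u x = h x.1 * zpow t x.2}.
Proof.
move=> th; pose v (x : sdprod phi) := h x.1 * zpow t x.2.
have thk k f : zpow t k * h f = h (phi k f) * zpow t k.
  elim/int_rect: k f => [|k IH|k IH] f.
  - by rewrite zpow0 mul1g mulg1 (gact1 phi).
  - rewrite -[Posz k.+1]/(1 + Posz k)%R zpow_succ -mulgA IH mulgA th -mulgA.
    by rewrite -(gactM phi).
  - have E : (- Posz k)%R = (1 + - Posz k.+1)%R by lia.
    apply: (@mulgI _ t); rewrite !mulgA -zpow_succ -E IH th -mulgA -zpow_succ.
    by rewrite -(gactM phi) E.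
have vM : {morph v : x y / x * y}.
  move=> [x a] [y b]; rewrite /v /= homM -mulgA zpowD -!mulgA.
  by congr (_ * _); rewrite !mulgA thk.
by exists (mkhom vM).
Qed.

End FreeByCyclic.

Lemma free_basis_generated (F : groupType) n (b : 'I_n -> F) :
  free_basis b -> forall f, generated [set` codom b] f.
Proof.
move=> Fb; apply: (free_ind Fb); first exact: subgroup_generated.
by move=> i; apply: mem_generated => /=; apply: codom_f.
Qed.

Lemma free_by_cyclic_character (G : groupType) : free_by_cyclic G ->
  exists xi : {multiplicative G -> Zgroup},
    (exists t, zchar xi t = 1%R) /\ fg_ker xi.
Proof.
case=> F [[n [b Fb]] [phi [th [th' thK th'K]]]].
have th'M := can2_gmulfM thK th'K.
exists (comp_hom (sd_snd phi) th); split.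
  by exists (th' (sd_t phi)); rewrite /zchar /= th'K.
exists [seq th' (sd_inl phi f) | f <- codom b]; split.
  by move=> _ /mapP[f _ ->]; rewrite /zchar /= th'K.
move=> g g0; rewrite -[g]thK; move: g0; rewrite /zchar /=.
case: (th g) => f k /= ->; rewrite -/(sd_inl phi f).
set B := generated _; pose th'i := comp_hom (mkhom th'M) (sd_inl_hom phi).
move: f (free_basis_generated Fb f).
apply: (@generated_sub _ _ (th'i @^-1` B)) => [|f fb].
  exact/subgroup_preim/subgroup_generated.
by apply: mem_generated => /=; apply/mapP; exists f.
Qed.

Lemma commutator_subgroup_char (G : groupType)
    (psi : {multiplicative G -> Zgroup}) x :
  commutator_subgroup G x -> zchar psi x = 0%R.
Proof.
apply: (@generated_sub _ _ [set x | zchar psi x = 0%R]).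
  exact: (subgroup_equal psi (triv_hom G Zgroup)).
by move=> _ [[y z] _ <-] /=; rewrite !(zcharM, zcharV); lia.
Qed.

Lemma cyclic_zpow (G : groupType) (g : G) :
  generated [set g] = setT -> forall x, exists k, x = zpow g k.
Proof.
move=> gT x; have : generated [set g] x by rewrite gT.
apply: (@generated_sub _ _ [set x | exists k, x = zpow g k]).
  split=> [|_ _ [k ->] [l ->]|_ [k ->]].
  - by exists 0%R.
  - by exists (k + l)%R; rewrite zpowD.
  - by exists (- k)%R; rewrite zpowN.
by move=> _ ->; exists 1%R; rewrite zpow1.
Qed.

Lemma infinite_order (G : groupType) (g : G) : generated [set g] = setT ->
  infinite_set [set: G] <-> (forall k, zpow g k = 1 -> k = 0%R).
Proof.
move=> /cyclic_zpow gT; split=> [Ginf k gk|gk].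
  apply: contrapT => k0; apply: Ginf.
  apply: (@sub_finite_set _ _ ((fun n : nat => zpow g n) @` `I_`|k|%N)).
    move=> x _; have [m ->] := gT x; exists `|(m %% k)%Z|%N.
      by rewrite /=; have := ltz_pmod m (d := `|k|%N); rewrite modz_abs; lia.
    have gkq q : zpow g (q * k)%R = 1.
      elim/int_rect: q => [|q IH|q IH]; first by rewrite mul0r.
        by rewrite -[Posz q.+1]/(1 + Posz q)%R mulrDl mul1r zpowD
          gk IH mulg1.
      move: IH; rewrite (_ : (- Posz q * k)%R = (k + - Posz q.+1 * k)%R); last lia.
      by rewrite zpowD gk mul1g.
    rewrite {2}(divz_eq m k) zpowD gkq mul1g; congr zpow.
    by have := @modz_ge0 m k; lia.
  exact/finite_image/finite_II.
move=> Gfin; apply: infinite_nat.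
rewrite -[setT](preimage_setT (fun n : nat => zpow g n)).
apply: finite_preimage => // m n _ _ E.
suff: (Posz m - Posz n = 0)%R by lia.
by apply: gk; rewrite zpowD zpowN E mulgV.
Qed.

Section Forward.
Variables (G0 G1 G2 G : groupType).
Variables (f1 : {multiplicative G0 -> G1}) (f2 : {multiplicative G0 -> G2}).
Variables (j1 : {multiplicative G1 -> G}) (j2 : {multiplicative G2 -> G}).
Hypothesis GA : is_amalgam f1 f2 j1 j2.
Hypotheses (f1I : injective f1) (f2I : injective f2).
Hypotheses (f1P : range f1 <> setT) (f2P : range f2 <> setT).

(** The two factors generate [G], so the fibration is nonzero on one of them; that factor plays the
    role of [G1] in [edge_group_escapes_kernel]. *)
Lemma free_by_cyclic_amalgam_character : free_by_cyclic G ->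
  exists (xi : {multiplicative G -> Zgroup}) z, zchar xi (j1 (f1 z)) <> 0%R.
Proof.
move=> /free_by_cyclic_character[xi [[t xit] xiK]]; exists xi.
have ex (T U : Type) (f : T -> U) : range f <> setT -> exists y, ~ range f y.
  move=> fP; apply: contrapT => /forallNP fT; apply: fP.
  by apply/seteqP; split=> // y _; apply: contrapT; apply: fT.
have [u1|u1] := pselect (exists u, zchar xi (j1 u) <> 0%R).
  exact: (edge_group_escapes_kernel GA f1I f2I xiK u1 (ex _ _ _ f2P)).
have [u2|u2] := pselect (exists u, zchar xi (j2 u) <> 0%R).
  have [z zE] := edge_group_escapes_kernel (amalgam_sym GA) f2I f1I xiK u2
    (ex _ _ _ f1P).
  by exists z; rewrite GA.1.
have : zchar xi t = 0%R.
  move: t {xit}; apply: (amalgam_ind GA (A := [set t | zchar xi t = 0%R])).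
  - exact: (subgroup_equal xi (triv_hom G Zgroup)).
  - by move=> x; apply: contrapT => E; case: u1; exists x.
  - by move=> x; apply: contrapT => E; apply: u2; exists x.
by rewrite xit.
Qed.

End Forward.

(** Characters kill commutators, and one that is nonzero at a generator of a cyclic group vanishes
    on no nontrivial element of it. *)
Lemma meets_commutators_trivially (G0 G1 : groupType) (g : G0)
    (f1 : {multiplicative G0 -> G1}) (psi : {multiplicative G1 -> Zgroup}) :
    generated [set g] = setT -> zchar psi (f1 g) <> 0%R ->
  range f1 `&` commutator_subgroup G1 = [set 1].
Proof.
move=> gT psig; apply/seteqP; split=> [x [[z _ <-] /= cz]|x ->]; last first.
  split; first by exists 1; rewrite ?hom1.
  exact: generated1.
have [k zE] := cyclic_zpow gT z; rewrite zE.
have := commutator_subgroup_char psi cz; rewrite zE hom_zpow zchar_zpow.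
by move=> ?; have -> : k = 0%R by nia.
Qed.

(** * Finite generation of kernels *)

(* The subgroupoids [Q] of the groupoid of the action of [G] on the integers
   through [psi]; an arrow is [g] together with its source [x]. *)
Definition subgroupoid (G : groupType) (psi : {multiplicative G -> Zgroup})
    (Q : G -> int -> Prop) : Prop :=
  [/\ forall x, Q 1 x,
      forall g f x, Q f x -> Q g (zchar psi f + x)%R -> Q (g * f) x
    & forall f x, Q f x -> Q f^-1 (zchar psi f + x)%R].

Section Subgroupoid.
Variables (G : groupType) (psi : {multiplicative G -> Zgroup}).
Variables (Q : G -> int -> Prop).
Hypothesis QP : subgroupoid psi Q.

Lemma subgroupoid_full : subgroup [set g | forall x, Q g x].
Proof.
case: QP => Q1 QM QV; split=> //= [g f Qg Qf x|f Qf x]; first exact: QM.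
by have := QV f (x - zchar psi f)%R (Qf _); rewrite addrC subrK.
Qed.

Lemma subgroupoid_vertex x : subgroup [set g | zchar psi g = 0%R /\ Q g x].
Proof.
case: QP => Q1 QM QV; split=> /= [|g f [g0 Qg] [f0 Qf]|f [f0 Qf]].
- by rewrite zchar1.
- split; first by rewrite zcharM g0 f0.
  by apply: QM => //; rewrite f0 add0r.
- by split; [rewrite zcharV f0|have := QV f x Qf; rewrite f0 add0r].
Qed.

Lemma subgroupoid_zpow z : (forall x, Q z x) -> forall q x, Q (zpow z q) x.
Proof.
move=> Qz q; have [S1 SM SV] := subgroupoid_full.
elim/int_rect: q => [|q IH|q IH]; first exact: S1.
  by rewrite -[Posz q.+1]/(1 + Posz q)%R zpow_succ; apply: SM.
have -> : (- Posz q.+1)%R = (- (1 + Posz q))%R by lia.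
rewrite zpowN zpow_succ invgM; apply: SM; first by rewrite -zpowN.
exact: SV.
Qed.

Lemma subgroupoid_preim (H : groupType) (j : {multiplicative H -> G}) :
  subgroupoid (comp_hom psi j) (fun h x => Q (j h) x).
Proof.
case: QP => Q1 QM QV; split=> [x|g f x|f x]; rewrite ?hom1 ?homM ?homV //.
  exact: QM.
exact: QV.
Qed.

End Subgroupoid.

(** Schreier's argument: the assumption says that the arrows of [z] and those in [L] generate the
    action groupoid. Contracting the orbit of 0 along a transversal [tau] sends arrows to elements
    of the kernel, and the images of generating arrows generate the kernel. *)
Lemma schreier_fg (G : groupType) (psi : {multiplicative G -> Zgroup}) z
    (L : seq (G * int)) : (0 < zchar psi z)%R ->
    (forall Q, subgroupoid psi Q -> (forall x, Q z x) ->
      (forall l, l \in L -> Q l.1 l.2) -> forall g x, Q g x) ->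
  fg_ker psi.
Proof.
set p := zchar psi z => p_gt0 gen.
pose O x := exists g, zchar psi g = x.
have [sg sgP] : {sg : int -> G & forall x, O x -> zchar psi (sg x) = x}.
  apply: (@choice _ _ (fun x g => O x -> zchar psi g = x)) => x.
  by have [[g gx]|nO] := pselect (O x); [exists g|exists 1].
(* Compatibility of [tau] with [z] makes the infinitely many arrows of [z] contract to 1, so only
   the finite list [L] contributes. *)
have [tau tauP tauz] : exists2 tau : int -> G,
    forall x, O x -> zchar psi (tau x) = x
    & forall x, tau (p + x)%R = z * tau x.
  exists (fun x => zpow z (x %/ p)%Z * sg (x %% p)%Z) => [x [g gx]|x].
    rewrite zcharM zchar_zpow sgP; first by rewrite -divz_eq.
    exists (zpow z (- (x %/ p)%Z)%R * g).
    by rewrite zcharM zchar_zpow gx -/p; have := divz_eq x p; lia.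
  rewrite modzDl divzDl ?dvdzz // divzz (_ : (p != 0)%R) /=; last lia.
  by rewrite zpow_succ mulgA.
pose e g x := (tau (zchar psi g + x)%R)^-1 * g * tau x.
have OM g x : O x -> O (zchar psi g + x)%R.
  by case=> h <-; exists (g * h); rewrite zcharM.
have e_ker g x : O x -> zchar psi (e g x) = 0%R.
  move=> Ox; rewrite !zcharM zcharV (tauP _ (OM g x Ox)) (tauP _ Ox); lia.
have eM g f x : e (g * f) x = e g (zchar psi f + x)%R * e f x.
  by rewrite /e zcharM addrA !gnorm.
have e1 x : e 1 x = 1.
  by rewrite /e zchar1 add0r mulg1 mulVg.
have eV f x : e f^-1 (zchar psi f + x)%R = (e f x)^-1.
  by apply: (@mulIg _ (e f x)); rewrite -eM !mulVg e1.
pose s := [seq e l.1 l.2 | l <- L & `[< O l.2 >]].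
exists s; split=> [_ /mapP[[g x]] + ->|k k0].
  by rewrite mem_filter => /andP[/asboolP/= Ox _]; apply: e_ker.
pose Q g x := O x -> generated [set` s] (e g x).
have QP : subgroupoid psi Q.
  split=> [x _|g f x Qf Qg Ox|f x Qf Ox].
  - by rewrite e1; apply: generated1.
  - by rewrite eM; apply: generatedM; [apply: Qg; apply: OM|apply: Qf].
  - rewrite eV; apply: generatedV; apply: Qf; case: Ox => g gx.
    by exists (f^-1 * g); rewrite zcharM zcharV gx; lia.
have Qz x : Q z x.
  by move=> _; rewrite /e tauz invgM mulgVK mulVg; apply: generated1.
have QL l : l \in L -> Q l.1 l.2.
  move=> lL Ol; apply: mem_generated => /=; apply/mapP; exists l => //.
  by rewrite mem_filter lL andbT; apply/asboolP.
have O0 : O 0%R by exists 1; rewrite zchar1.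
(* The base point [tau 0] need not be 1; the conjugate of [k] by it contracts to exactly [k]. *)
have := gen Q QP Qz QL (tau 0%R * k * (tau 0%R)^-1) 0%R O0.
rewrite /e !zcharM zcharV k0 (tauP _ O0) !(oppr0, addr0).
by rewrite !gnorm.
Qed.

(** Precomposing with a power of [z] moves the source of an arrow into the window from 0 to [p - 1].
    There an element is a power of [z] times a representative [sg r], with [r] in the window, times
    an element of the kernel, so finitely many arrows suffice. *)
Lemma window_generates (G H : groupType) (psi : {multiplicative G -> Zgroup})
    (j : {multiplicative H -> G}) (z : H) :
    (0 < zchar psi (j z))%R -> fg_ker (comp_hom psi j) ->
  exists L : seq (G * int), forall Q, subgroupoid psi Q ->
    (forall x, Q (j z) x) -> (forall l, l \in L -> Q l.1 l.2) ->
    forall h x, Q (j h) x.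
Proof.
set p := zchar psi (j z) => p_gt0 [s [s0 sker]].
pose O x := exists g, zchar psi (j g) = x.
have [sg sgP] : {sg : int -> H & forall x, O x -> zchar psi (j (sg x)) = x}.
  apply: (@choice _ _ (fun x g => O x -> zchar psi (j g) = x)) => x.
  by have [[g gx]|nO] := pselect (O x); [exists g|exists 1].
pose win := [seq Posz r | r <- iota 0 `|p|].
have winP x : (x %% p)%Z \in win.
  apply/mapP; exists `|(x %% p)%Z|%N; last by have := @modz_ge0 x p; lia.
  by rewrite mem_iota; have := @ltz_pmod x p; have := @modz_ge0 x p; lia.
exists ([seq (j k, r) | k <- s, r <- win] ++
        [seq (j (sg q), r) | q <- win, r <- win]).
move=> Q QP Qz QL.
have [Q1 QM QV] := QP; have Qzq := subgroupoid_zpow QP Qz.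
have Qker x k : x \in win -> zchar psi (j k) = 0%R -> Q (j k) x.
  move=> xw /sker; have [S1 SM SV] := subgroupoid_vertex (subgroupoid_preim QP j) x.
  move=> kS; apply: (proj2 (A := zchar psi (j k) = 0%R)); move: k kS.
  apply: (@generated_sub _ _ [set k | zchar (comp_hom psi j) k = 0%R /\ Q (j k) x]).
    by split.
  move=> k ks; split; first exact: s0.
  apply: (QL (_, _)); rewrite mem_cat; apply/orP; left.
  by apply/allpairsP; exists (k, x); split.
have Qwin g x : x \in win -> Q (j g) x.
  move=> xw; pose q := (zchar psi (j g) %/ p)%Z; pose r := (zchar psi (j g) %% p)%Z.
  have Er : zchar psi (j (sg r)) = r.
    apply: sgP; exists (zpow z (- q)%R * g).
    rewrite homM zcharM hom_zpow zchar_zpow -/p.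
    by have := divz_eq (zchar psi (j g)) p; rewrite -/q -/r; lia.
  pose k := (sg r)^-1 * zpow z (- q)%R * g.
  have k0 : zchar psi (j k) = 0%R.
    rewrite !homM !zcharM homV zcharV Er hom_zpow zchar_zpow -/p.
    by have := divz_eq (zchar psi (j g)) p; rewrite -/q -/r; lia.
  have -> : j g = zpow (j z) q * j (sg r) * j k.
    by rewrite -hom_zpow -!homM /k !mulgA mulgK -zpowD addrN mul1g.
  apply: (QM); first exact: Qker.
  rewrite k0 add0r; apply: (QM) => //.
  apply: (QL (_, _)); rewrite mem_cat; apply/orP; right.
  by apply/allpairsP; exists (r, x); split=> //; apply: winP.
move=> h x; have := Qwin (h * zpow z (x %/ p)%Z) _ (winP x).
have Ex : (zchar psi (zpow (j z) (x %/ p)%Z) + (x %% p)%Z)%R = x.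
  by rewrite zchar_zpow -/p -divz_eq.
have := QV _ _ (Qzq (x %/ p)%Z (x %% p)%Z); rewrite Ex => Qi Qw.
rewrite -[j h](mulgK (zpow (j z) (x %/ p)%Z)).
apply: QM => //; rewrite -{3}Ex zcharV addKr.
by rewrite -hom_zpow -homM.
Qed.

Section AmalgamKernel.
Variables (G0 G1 G2 G : groupType).
Variables (f1 : {multiplicative G0 -> G1}) (f2 : {multiplicative G0 -> G2}).
Variables (j1 : {multiplicative G1 -> G}) (j2 : {multiplicative G2 -> G}).
Hypothesis GA : is_amalgam f1 f2 j1 j2.

Lemma amalgam_fg_ker (psi : {multiplicative G -> Zgroup}) z :
    (0 < zchar psi (j1 (f1 z)))%R ->
    fg_ker (comp_hom psi j1) -> fg_ker (comp_hom psi j2) ->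
  fg_ker psi.
Proof.
move=> z_gt0 K1 K2.
have [L1 L1P] := window_generates z_gt0 K1.
have z_gt0' : (0 < zchar psi (j2 (f2 z)))%R by rewrite -GA.1.
have [L2 L2P] := window_generates z_gt0' K2.
apply: (schreier_fg (L := L1 ++ L2) z_gt0) => Q QP Qz QL.
apply: (amalgam_ind GA (subgroupoid_full QP)) => [h x|h x] /=.
  by apply: L1P => // l ll; apply: QL; rewrite mem_cat ll.
apply: L2P => // [y|l ll]; first by rewrite -GA.1.
by apply: QL; rewrite mem_cat ll orbT.
Qed.

End AmalgamKernel.

(** * Recursion and induction along the integers *)

Lemma int_down_ind (P : int -> Prop) (m0 : int) :
    (forall m, (m0 <= m)%R -> P m) ->
    (forall m, (m < m0)%R -> (forall y, (m < y)%R -> P y) -> P m) ->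
  forall m, P m.
Proof.
move=> P0 PS m; have [k] := ubnP `|(m0 - m)%R|%N; elim: k m => // k IH m mk.
have [|mm0] := lerP m0 m; first exact: P0.
apply: PS => // y my; have [|ym0] := lerP m0 y; first exact: P0.
by apply: IH; lia.
Qed.

Lemma int_up_ind (P : int -> Prop) (m0 : int) :
    (forall m, (m < m0)%R -> P m) ->
    (forall m, (m0 <= m)%R -> (forall y, (y < m)%R -> P y) -> P m) ->
  forall m, P m.
Proof.
move=> P0 PS m; rewrite -[m]opprK.
apply: (@int_down_ind (fun m => P (- m)%R) (1 - m0)%R) => {}m mm0.
  by apply: P0; lia.
move=> Py; apply: PS => [|y ym]; first lia.
by rewrite -[y]opprK; apply: Py; lia.
Qed.

(** The value at [m] is computed with fuel; since [Phi] only looks at levels above [m], any fuel of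
    at least [m0 - m] gives the same result. *)
Lemma int_down_rec (V : Type) (Phi : (int -> V) -> int -> V) c0 (m0 : int) :
    (forall c c' m, (forall y, (m < y)%R -> c y = c' y) -> Phi c m = Phi c' m) ->
  exists c, (forall m, (m0 <= m)%R -> c m = c0 m) /\
            (forall m, (m < m0)%R -> c m = Phi c m).
Proof.
move=> loc.
pose it := fix it k m :=
  if k is k'.+1 then (if (m < m0)%R then Phi (it k') m else c0 m) else c0 m.
have it0 k m : (m0 <= m)%R -> it k m = c0 m.
  by case: k => //= k; rewrite leNgt => /negbTE->.
have stab k k' m : (m0 - m <= Posz k)%R -> (m0 - m <= Posz k')%R -> it k m = it k' m.
  elim: k k' m => [|k IH] k' m mk mk'; first by rewrite !it0 //; lia.
  have [mm0|mm0] := lerP m0 m; first by rewrite !it0.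
  case: k' mk' => [|k'] mk' /=; first lia.
  by rewrite mm0; apply: loc => y my; apply: IH; lia.
exists (fun m => it `|(m0 - m)%R|%N m); split=> m mm0; first exact: it0.
case E: `|(m0 - m)%R|%N => [|k] /=; first lia.
by rewrite mm0; apply: loc => y my; apply: stab; lia.
Qed.

Lemma int_up_rec (V : Type) (Phi : (int -> V) -> int -> V) c0 (m0 : int) :
    (forall c c' m, (forall y, (y < m)%R -> c y = c' y) -> Phi c m = Phi c' m) ->
  exists c, (forall m, (m < m0)%R -> c m = c0 m) /\
            (forall m, (m0 <= m)%R -> c m = Phi c m).
Proof.
move=> loc.
have [|c [cl cg]] := @int_down_rec V
  (fun c m => Phi (fun y => c (- y)%R) (- m)%R) (fun y => c0 (- y)%R) (1 - m0)%R.
  by move=> c c' m E; apply: loc => y ym; apply: E; lia.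
exists (fun y => c (- y)%R); split=> m mm0.
  by rewrite cl ?opprK //; lia.
by rewrite cg ?opprK //; lia.
Qed.

(** * Characters of free-by-cyclic groups near the fibration *)

(** Quantifying over subgroupoids expresses, without words, that the arrow of [f] at [x] is composed
    of basis arrows, and their inverses, whose basis arrows start within distance [B] of [x]. *)
Definition supported (I : Type) (F : groupType) (b : I -> F)
    (al : {multiplicative F -> Zgroup}) (B : nat) (f : F) : Prop :=
  forall Q, subgroupoid al Q -> forall x : int,
    (forall i y, (x - Posz B <= y)%R -> (y <= x + Posz B)%R -> Q (b i) y) -> Q f x.

Section Support.
Variables (I : Type) (F : groupType) (b : I -> F).
Variables (al : {multiplicative F -> Zgroup}).

Lemma supportedW B B' f : (B <= B')%N ->
  supported b al B f -> supported b al B' f.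
Proof.
by move=> BB' fB Q QP x Qx; apply: fB => // i y y1 y2; apply: Qx; lia.
Qed.

Lemma supported_exists : free_on b -> forall f, exists B, supported b al B f.
Proof.
move=> Fb; apply: (free_ind Fb (A := [set f | exists B, supported b al B f])).
  split=> [|g f [B gB] [B' fB]|f [B fB]].
  - by exists 0%N => Q [Q1 _ _] x _.
  - exists (B + B' + `|zchar al f|)%N => Q QP x Qx; case: (QP) => _ QM _.
    by apply: QM; [apply: fB|apply: gB] => // i y y1 y2; apply: Qx; lia.
  - exists (B + `|zchar al f|)%N => Q QP x Qx; case: (QP) => _ _ QV.
    have := QV f (x - zchar al f)%R.
    rewrite [(zchar _ _ + _)%R]addrC subrK; apply.
    by apply: fB => // i y y1 y2; apply: Qx; lia.
by move=> i; exists 0%N => Q _ x Qx; apply: Qx; lia.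
Qed.

Lemma supported_family n (g : 'I_n -> F) :
  free_on b -> exists B, forall i, supported b al B (g i).
Proof.
move=> Fb; have [B BP] := choice (fun i => supported_exists Fb (g i)).
exists (\max_i B i)%N => i; apply: supportedW (BP i).
exact: (leq_bigmax i).
Qed.

End Support.

Definition liftable (G : groupType) (psi : {multiplicative G -> Zgroup}) : Prop :=
  forall (A A' : groupType) (p : {multiplicative A' -> A})
    (u : {multiplicative G -> A}), (forall a, exists a', p a' = a) ->
  exists h : {multiplicative G -> wreath A' Zgroup},
    forall g, (h g).2 = psi g /\ forall x, p ((h g).1 x) = u g.

Section CocycleRelations.
Variables (G A : groupType) (psi : {multiplicative G -> Zgroup}).
Variable h : {multiplicative G -> wreath A Zgroup}.
Hypothesis hE : forall g, (h g).2 = psi g.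

Lemma cocycleM g f (x : int) :
  (h (g * f)).1 x = (h g).1 (zchar psi f + x)%R * (h f).1 x.
Proof. by rewrite homM wrM1 hE. Qed.

Lemma cocycle1 (x : int) : (h 1).1 x = 1.
Proof. by rewrite hom1. Qed.

Lemma cocycleV f (x : int) : (h f^-1).1 (zchar psi f + x)%R = ((h f).1 x)^-1.
Proof. by apply: (@mulIg _ ((h f).1 x)); rewrite -cocycleM !mulVg cocycle1. Qed.

(** The arrows on which a cocycle lifts [u] are closed under composition and inversion, so lifting
    can be checked on generating arrows. *)
Lemma subgroupoid_lift (A' : groupType) (p : {multiplicative A -> A'})
    (u : {multiplicative G -> A'}) :
  subgroupoid psi (fun g x => p ((h g).1 x) = u g).
Proof.
split=> [x|g f x Qf Qg|f x Qf]; first by rewrite cocycle1 !hom1.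
  by rewrite cocycleM !homM Qf Qg.
by rewrite cocycleV !homV Qf.
Qed.

End CocycleRelations.

Lemma subgroupoid_eq (G A : groupType) (psi : {multiplicative G -> Zgroup})
    (h h' : {multiplicative G -> wreath A Zgroup}) :
    (forall g, (h g).2 = psi g) -> (forall g, (h' g).2 = psi g) ->
  subgroupoid psi (fun g x => (h g).1 x = (h' g).1 x).
Proof.
move=> hE h'E; split=> [x|g f x Qf Qg|f x Qf]; first by rewrite !cocycle1.
  by rewrite (cocycleM hE) (cocycleM h'E) Qf Qg.
by rewrite (cocycleV hE) (cocycleV h'E) Qf.
Qed.

Section Fibration.
Variables (F : groupType) (n : nat) (b : 'I_n -> F) (phi : group_action Zgroup F).
Variable psi : {multiplicative sdprod phi -> Zgroup}.
Hypothesis Fb : free_on b.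

Local Notation inl := (sd_inl_hom phi).
Local Notation t := (sd_t phi).
Local Notation phi1 := (phi 1%Z).
Local Notation phiV := (phi (-1)%Z).
Let al := comp_hom psi inl.
Let N := zchar psi t.

(** Closeness to the fibration: [t] shifts levels by more than the spread [B] of the conjugates of
    basis elements by [t] and by its inverse. *)
Variable B : nat.
Hypothesis phi1_supp : forall i, supported b al B (phi1 (b i)).
Hypothesis phiV_supp : forall i, supported b al B (phiV (b i)).
Hypothesis BN : (Posz B < N)%R.

Lemma phi1K f : phiV (phi1 f) = f.
Proof. by rewrite -(gactM phi) (gact1 phi). Qed.

Lemma phiVK f : phi1 (phiV f) = f.
Proof. by rewrite -(gactM phi) (gact1 phi). Qed.

Lemma char_phi f : zchar al (phi1 f) = zchar al f.
Proof.
have := congr1 (zchar psi) (sd_relation phi f); rewrite !zcharM => E.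
by apply: (addrI (zchar psi t)); rewrite addrC; apply: esym E.
Qed.

(** Conjugation by [t] or its inverse expresses a basis arrow far from 0 through basis arrows
    strictly closer to 0, so finitely many levels generate. *)
Lemma fibration_fg_ker : fg_ker psi.
Proof.
have N_gt0 : (0 < N)%R by lia.
(* Beyond [M], a shift by [N] towards 0 followed by a spread of [B] neither overshoots 0 nor, as
   [B < N], returns to the starting level. *)
pose M := (`|N| + B)%N.
pose L := [seq (inl (b i), (Posz r - Posz M)%R) | i <- enum 'I_n, r <- iota 0 M.*2.+1].
apply: (schreier_fg (L := L) N_gt0) => Q QP Qt QL.
have [Q1 QM QV] := QP; have QiP := subgroupoid_preim QP inl.
have [_ _ QfV] := subgroupoid_full QP; have QtV := QfV t Qt.
have Qb i x : Q (inl (b i)) x.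
  move: i; have [k] := ubnP `|x|%N; elim: k x => // k IH x xk i.
  have [xM|xM] := leqP `|x|%N M.
    apply: (QL (_, _)); apply/allpairsP; exists (i, `|(x + Posz M)%R|%N).
    rewrite mem_enum mem_iota; split=> //=; first lia.
    by congr pair; lia.
  have [x0|x0] := lerP 0%R x.
    have -> : inl (b i) = t * inl (phiV (b i)) * t^-1.
      by rewrite sd_relation phiVK mulgK.
    apply: (QM) => //; apply: (QM) => //; rewrite zcharV.
    by apply: (phiV_supp i QiP) => j y y1 y2; apply: IH; lia.
  have -> : inl (b i) = t^-1 * inl (phi1 (b i)) * t.
    by rewrite -mulgA -sd_relation mulKg.
  apply: (QM) => //; apply: (QM) => //.
  by apply: (phi1_supp i QiP) => j y y1 y2; apply: IH; rewrite -/N in y1 y2 *; lia.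
move=> g; rewrite (sdE g); have [S1 SM SV] := subgroupoid_full QP.
apply: SM; last exact: (subgroupoid_zpow QP Qt).
by apply: (free_ind Fb (subgroupoid_full QiP)) => i /=; apply: Qb.
Qed.

(* A lift is determined by its values [v x i] on [(b i, x)]. Those at [x < 0]
   are computed downwards from those at [x >= 0] by the relation
   [t f = phi f t], which then holds below the level [- B]; the values at the
   levels [>= N - B] are recomputed upwards, by the same relation, from the ones
   below. As [N > B], each step only uses levels that are already known, and the
   relation finally holds everywhere. *)
Lemma fibration_liftable : liftable psi.
Proof.
move=> A A' p u p_surj.
have [sec secK] := choice p_surj.
pose s := sec (u t); pose lvl (v : int -> 'I_n -> A') i : wreath A' Zgroup :=
  (fun x => v x i, psi (inl (b i))).
(* By freeness, arbitrary values on the basis arrows extend to a cocycle on [F]. *)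
pose ext v := sval (free_hom Fb (lvl v)).
have extb v i : ext v (b i) = lvl v i by rewrite /ext; case: free_hom.
have ext2 v f : (ext v f).2 = al f.
  apply: (free_ext Fb (f := comp_hom (wr_snd _ _) (ext v)) (f' := al)) => i /=.
  by rewrite extb.
pose c v f x := (ext v f).1 x.
have cb v i x : c v (b i) x = v x i by rewrite /c extb.
have c_local f v v' x : supported b al B f ->
    (forall y, (x - Posz B <= y)%R -> (y <= x + Posz B)%R -> v y = v' y) ->
    c v f x = c v' f x.
  move=> fB vv'; apply: (fB _ (subgroupoid_eq (ext2 v) (ext2 v'))) => i y y1 y2.
  by rewrite -/(c v _ _) -/(c v' _ _) !cb vv'.
have uphi f : u (inl (phi1 f)) = u t * u (inl f) * (u t)^-1.
  by rewrite -homM sd_relation homM mulgK.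
have uphiV f : u (inl (phiV f)) = (u t)^-1 * u (inl f) * u t.
  by rewrite -{2}(phiVK f) uphi !gnorm.
(* With the cocycle of [t] constantly [s], the relation [t f = phi f t] at level [m] reads
   [s * c v f m = c v (phi1 f) (m + N) * s]; it is solved here for the lower level. *)
pose Phi1 (v : int -> 'I_n -> A') m i := s^-1 * c v (phi1 (b i)) (m + N)%R * s.
have [|v1 [v1_ge v1_lt]] := @int_down_rec _ Phi1 (fun _ i => sec (u (inl (b i)))) 0%R.
  move=> v v' m vv'; apply/funext => i; rewrite /Phi1; congr (_ * _ * _).
  by apply: c_local => // y y1 y2; apply: vv'; lia.
have v1E m i : (m < 0)%R ->
    c v1 (b i) (m + N - N)%R = s^-1 * c v1 (phi1 (b i)) (m + N)%R * s.
  by move=> m0; rewrite addrK cb v1_lt.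
have R1 : subgroupoid al (fun f x => c v1 (phi1 f) (x + N)%R = s * c v1 f x * s^-1).
  have phiM : {morph phi1 : f g / f * g} by apply: gact_morph.
  have phi11 : phi1 1 = 1 := hom1 (mkhom phiM).
  have phiVi f : phi1 f^-1 = (phi1 f)^-1 := homV (mkhom phiM) f.
  split=> [x|g f x Rf Rg|f x Rf].
  - by rewrite phi11 /c !cocycle1 mulg1 mulgV.
  - rewrite phiM /c (cocycleM (ext2 v1)) [in RHS](cocycleM (ext2 v1)).
    by rewrite -!/(c v1 _ _) Rf char_phi addrA Rg !gnorm.
  - rewrite phiVi -addrA -(char_phi f) /c (cocycleV (ext2 v1)).
    by rewrite char_phi (cocycleV (ext2 v1)) -!/(c v1 _ _) Rf !gnorm.
(* The relation solved for the upper level; the arrow of [phiV (b i)] at [m] must use negative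
   levels only, where [v1] satisfies the recursion. *)
have R1V m i : (m + Posz B < 0)%R ->
    c v1 (b i) (m + N)%R = s * c v1 (phiV (b i)) m * s^-1.
  move=> m0; rewrite -{1}(phiVK (b i)); apply: (phiV_supp i R1) => j y y1 y2.
  by rewrite cb v1_lt ?/Phi1 ?gnorm //; lia.
pose Phi2 (v : int -> 'I_n -> A') m i := s * c v (phiV (b i)) (m - N)%R * s^-1.
(* Below [N - B] the relation already follows from [R1V], which applies at [m - N] as soon as
   [m - N + B < 0]. *)
have [|v2 [v2_lt v2_ge]] := @int_up_rec _ Phi2 v1 (N - Posz B)%R.
  move=> v v' m vv'; apply/funext => i; rewrite /Phi2; congr (_ * _ * _).
  by apply: c_local => // y y1 y2; apply: vv'; lia.
have R2 m i : c v2 (b i) m = s * c v2 (phiV (b i)) (m - N)%R * s^-1.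
  rewrite cb; have [mge|mlt] := lerP (N - Posz B)%R m; first by rewrite v2_ge.
  rewrite v2_lt // -cb -{1}[m](subrK N) R1V; last lia.
  congr (_ * _ * _); apply: c_local => // y y1 y2; rewrite v2_lt //; lia.
pose T : wreath A' Zgroup := (fun=> s, N : Zgroup).
have conjM : {morph (fun f => T * ext v2 (phiV f) * T^-1) : f g / f * g}.
  by move=> f g; rewrite (gact_morph phi) homM !gnorm.
have RT f : T * ext v2 f = ext v2 (phi1 f) * T.
  apply: (@mulIg _ T^-1); rewrite mulgK -{1}(phi1K f); move: (phi1 f) => {}f.
  apply: (free_ext Fb (f := mkhom conjM)) => i /=.
  apply: wr_eq => [x|].
    rewrite -[LHS]/(s * c v2 (phiV (b i)) (- N + x)%R * s^-1) addrC.
    by rewrite -R2.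
  rewrite !wrM2 wrV2 !ext2.
  rewrite -[LHS]/(N + zchar al (phiV (b i)) - N)%R -char_phi phiVK.
  by rewrite addrAC subrr add0r.
have [h hE] := sd_hom RT.
have hinl f : h (inl f) = ext v2 f by rewrite hE /= mulg1.
have ht : h t = T by rewrite hE hom1 mul1g zpow1.
have h2 g : (h g).2 = psi g.
  rewrite (sdE g) !homM wrM2 -/(inl _) hinl ext2; congr (_ * _).
  by rewrite !hom_zpow ht wr_zpow2.
have pext v B' f x : supported b al B' f ->
    (forall i y, (x - Posz B' <= y)%R -> (y <= x + Posz B')%R ->
      p (v y i) = u (inl (b i))) ->
    p (c v f x) = u (inl f).
  move=> fB pv; apply: (fB _ (subgroupoid_lift (ext2 v) p (comp_hom u inl))).
  by move=> i y y1 y2; rewrite -/(c v _ _) cb pv.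
(* The initial values lift [u], and each recursion step conjugates by the lift [s] of [u t], just as
   [u] does. *)
have pv1 m : forall i, p (v1 m i) = u (inl (b i)).
  move: m; apply: (@int_down_ind _ 0%R) => m m0 => [|IH] i.
    by rewrite v1_ge.
  rewrite v1_lt // /Phi1 !homM homV (pext _ _ _ _ (phi1_supp i)); last first.
    by move=> j y y1 y2; apply: IH; lia.
  by rewrite /s secK uphi !gnorm.
have pv2 m : forall i, p (v2 m i) = u (inl (b i)).
  move: m; apply: (@int_up_ind _ (N - Posz B)%R) => m m0 => [|IH] i.
    by rewrite v2_lt.
  rewrite v2_ge // /Phi2 !homM homV (pext _ _ _ _ (phiV_supp i)); last first.
    by move=> j y y1 y2; apply: IH; lia.
  by rewrite /s secK uphiV !gnorm.
exists h => g; split; [exact: h2|move: g].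
have QP := subgroupoid_lift h2 p u; have [_ SM _] := subgroupoid_full QP.
have Qt x : p ((h t).1 x) = u t by rewrite ht /= /s secK.
move=> g; rewrite (sdE g); apply: SM; last exact: (subgroupoid_zpow QP Qt).
move=> x /=; have [B' fB'] := supported_exists al Fb g.1.
by rewrite -/(inl _) hinl; apply: (pext _ _ _ _ fB') => i y _ _.
Qed.

End Fibration.

(** * Abelianizations and invariant characters *)

Section Commutators.
Variable G : groupType.
Local Notation D := (commutator_subgroup G).

Lemma commutatorsM x y : D x -> D y -> D (x * y).
Proof. exact: generatedM. Qed.

Lemma commutatorsV x : D x -> D x^-1.
Proof. exact: generatedV. Qed.

Lemma mem_commutators (x y : G) : D (x * y * x^-1 * y^-1).
Proof.
apply: mem_generated; exists (x^-1, y^-1) => //=.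
by rewrite /commg /conjg !gnorm.
Qed.

Lemma commutatorsJ x d : D d -> D (x * d * x^-1).
Proof.
move=> Dd; rewrite -[_ / x](mulgVK d).
by apply: commutatorsM => //; apply: mem_commutators.
Qed.

Lemma commutators_congr x x' y y' :
  D (x / x') -> D (y / y') -> D (x * y / (x' * y')).
Proof.
move=> Dx Dy; have -> : x * y / (x' * y') = x * (y / y') * x^-1 * (x / x').
  by rewrite !gnorm.
by apply: commutatorsM => //; apply: commutatorsJ.
Qed.

Lemma commutators_trans y x z : D (x / y) -> D (y / z) -> D (x / z).
Proof. by move=> Dx /(commutatorsM Dx); rewrite mulgA mulgVK. Qed.

End Commutators.

Lemma hom_commutators (G H : groupType) (f : {multiplicative G -> H}) x :
  commutator_subgroup G x -> commutator_subgroup H (f x).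
Proof.
apply: (@generated_sub _ _ (f @^-1` commutator_subgroup H)).
  exact/subgroup_preim/subgroup_generated.
move=> _ [[y z] _ <-] /=; apply: mem_generated; exists (f y, f z) => //=.
by rewrite /commg /conjg !homM !homV.
Qed.

Section ExponentSums.
Variables (F : groupType) (n : nat) (b : 'I_n -> F).
Hypothesis Fb : free_on b.

Lemma dual_basis : {e : 'I_n -> {multiplicative F -> Zgroup} |
  forall i j, zchar (e j) (b i) = (i == j : int)}.
Proof.
have ex j : {e : {multiplicative F -> Zgroup} |
    forall i, zchar e (b i) = (i == j : int)}.
  by have [e eE] := free_hom Fb (fun i => (i == j : int) : Zgroup); exists e.
by exists (fun j => sval (ex j)) => i j; case: (ex j).
Qed.

Variable e : 'I_n -> {multiplicative F -> Zgroup}.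
Hypothesis eE : forall i j, zchar (e j) (b i) = (i == j : int).

Definition monomial (y : 'I_n -> int) : F := \prod_(i < n) zpow (b i) (y i).

Lemma char_monomial (psi : {multiplicative F -> Zgroup}) y :
  zchar psi (monomial y) = (\sum_i y i * zchar psi (b i))%R.
Proof.
rewrite /monomial (big_morph (zchar psi) (zcharM psi) (zchar1 psi)).
by apply: eq_bigr => i _; rewrite zchar_zpow.
Qed.

Lemma exponent_monomial j y : zchar (e j) (monomial y) = y j.
Proof.
rewrite char_monomial (bigD1 j) //= big1 => [|i ij].
  by rewrite eE eqxx mulr1 addr0.
by rewrite eE (negbTE ij) mulr0.
Qed.

Lemma monomialD y y' :
  commutator_subgroup F (monomial (fun i => y i + y' i)%R / (monomial y * monomial y')).
Proof.
rewrite /monomial; elim: (index_enum _) => [|i r IH].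
  by rewrite !big_nil !gnorm; apply: generated1.
rewrite !big_cons zpowD.
move: IH; set p := \prod_(j <- r) _; set q := \prod_(j <- r) _.
set q' := \prod_(j <- r) _; set x := zpow _ _; set x' := zpow _ _ => IH.
apply: (@commutators_trans _ (x * x' * (q * q'))).
  by apply: commutators_congr => //; rewrite mulgV; apply: generated1.
have -> : x * x' * (q * q') / (x * q * (x' * q')) =
    x * (x' * q * x'^-1 * q^-1) * x^-1 by rewrite !gnorm.
by apply: commutatorsJ; apply: mem_commutators.
Qed.

(** Modulo commutators every element equals the monomial of its exponent sums: both sides are
    multiplicative there and agree on the basis. *)
Lemma exponents_commutators f :
  (forall j, zchar (e j) f = 0%R) -> commutator_subgroup F f.
Proof.
pose m g := monomial (fun j => zchar (e j) g).
have m1 : m 1 = 1.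
  by rewrite /m /monomial big1 // => i _; rewrite zchar1.
have mM g h : commutator_subgroup F (m (g * h) / (m g * m h)).
  rewrite /m (_ : (fun j => zchar (e j) (g * h)) =
    fun j => zchar (e j) g + zchar (e j) h)%R; first exact: monomialD.
  by apply/funext => j; rewrite zcharM.
have fm : commutator_subgroup F (f / m f).
  apply: (free_ind Fb (A := [set f | commutator_subgroup F (f / m f)])).
    split=> [|{}f g /= fD gD|{}f /= fD].
    - by rewrite /= m1 mulgV; apply: generated1.
    - apply: (commutators_trans (commutators_congr fD gD)).
      by rewrite -invgF; apply: commutatorsV.
    - have := mM f f^-1; rewrite mulgV m1 mul1g => /commutatorsV.
      rewrite invgK => /(commutatorsJ (m f)^-1); rewrite invgK !gnorm => mD.
      move: fD => /(commutatorsJ (m f)^-1) /(commutatorsM mD).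
      by move=> /commutatorsV; rewrite !gnorm.
  move=> i /=; rewrite /m /monomial (_ : \prod_(j < n) _ = b i).
    by rewrite mulgV; apply: generated1.
  rewrite (eq_bigr (fun j => if j == i then b j else 1)) => [|j _].
    by rewrite -big_mkcond big_pred1_eq.
  by rewrite eE eq_sym; case: (j == i); rewrite ?zpow1.
move=> f0; move: fm; rewrite /m /monomial big1 ?divg1 // => i _.
by rewrite f0.
Qed.

End ExponentSums.

Lemma common_denominator n (x : 'I_n -> rat) :
  exists k : int, (k != 0)%R /\ exists y : 'I_n -> int,
    forall i, (k%:~R * x i = (y i)%:~R)%R.
Proof.
exists (\prod_i denq (x i))%R; split.
  by apply/prodf_neq0 => i _; rewrite denq_neq0.
exists (fun i => (\prod_(j < n | j != i) denq (x j)) * numq (x i))%R => i.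
rewrite (bigD1 i) //= !rmorphM /= numqE mulrC [RHS]mulrCA.
by congr (_ * _)%R; rewrite mulrC.
Qed.

Section InvariantCharacter.
Variables (F : groupType) (n : nat) (b : 'I_n -> F) (phi : group_action Zgroup F).
Hypothesis Fb : free_on b.
Local Notation inl := (sd_inl_hom phi).
Local Notation phi1 := (phi 1%Z).

(* If no invariant rational functional separates [f], then a multiple [k f] is
   in the image of [phi - 1] on the abelianization of [F], so that [f ^ k] is a
   product of commutators [[t, x]] and of commutators of [F]. *)
Lemma invariant_character f :
    (forall k, commutator_subgroup (sdprod phi) (zpow (inl f) k) -> k = 0%R) ->
  exists al : {multiplicative F -> Zgroup},
    (forall g, zchar al (phi1 g) = zchar al g) /\ zchar al f <> 0%R.
Proof.
move=> fD; have [e eE] := dual_basis Fb.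
pose P : {multiplicative F -> F} := mkhom (gact_morph phi 1%Z).
pose v : 'rV[rat]_n := (\row_j (zchar (e j) f)%:~R)%R.
pose M : 'M[rat]_n := (\matrix_(i, j) (zchar (e j) (phi1 (b i)))%:~R - 1%:M)%R.
have [/submxP[d vE]|] := boolP (v <= M)%MS.
  have [k [k0 [y yE]]] := common_denominator (fun i => d ord0 i).
  (* The vector [d] solving [v = d M], cleared of denominators, gives [u]; dividing [f ^ k] by
     [phi1 u / u] leaves zero exponent sums. *)
  pose u := monomial b y; pose g := zpow f k * (phi1 u / u)^-1.
  have g0 j : zchar (e j) g = 0%R.
    rewrite zcharM zcharV zcharM zcharV zchar_zpow (exponent_monomial eE).
    have -> : zchar (e j) (phi1 u) = (\sum_i y i * zchar (e j) (phi1 (b i)))%R.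
      exact: (char_monomial b (comp_hom (e j) P)).
    apply: (@intr_inj rat); rewrite !(rmorphD, rmorphN, rmorphM) /= rmorph_sum /=.
    have := congr1 (fun w : 'rV_n => (k%:~R * w ord0 j)%R) vE.
    rewrite !mxE => ->; rewrite mulr_sumr (eq_bigr (fun i =>
      (y i * zchar (e j) (phi1 (b i)))%:~R - (y i)%:~R * (i == j)%:R)%R).
      rewrite sumrB (_ : (\sum_i (y i)%:~R * (i == j)%:R = (y j)%:~R :> rat)%R).
        by rewrite subrr.
      rewrite (bigD1 j) //= eqxx mulr1 big1 ?addr0 // => i ij.
      by rewrite (negbTE ij) mulr0.
    by move=> i _; rewrite !mxE mulrA yE mulrBr rmorphM.
  suff /fD kE : commutator_subgroup (sdprod phi) (zpow (inl f) k).
    by rewrite kE eqxx in k0.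
  have -> : zpow (inl f) k = inl g * (inl (phi1 u) / inl u).
    have gE : g * (phi1 u / u) = zpow f k by rewrite mulgVK.
    by rewrite -hom_zpow -gE 2!homM homV.
  apply: commutatorsM.
    by apply: hom_commutators; apply: (exponents_commutators Fb eE).
  have -> : inl (phi1 u) = sd_t phi * inl u * (sd_t phi)^-1.
    by rewrite sd_relation mulgK.
  exact: mem_commutators.
(* The columns of the cokernel matrix are functionals that kill the rows of [M], hence invariant
   ones; some column is nonzero on [v]. *)
rewrite submxE; move: (cokermx M) (mulmx_coker M) => C MC /eqP/matrixP vK.
have [l vl] : exists l, (v *m C)%R ord0 l <> 0%R.
  apply: contrapT => /forallNP nl; apply: vK => i l; rewrite [RHS]mxE ord1.
  by apply: contrapT; apply: nl.
have [k [k0 [y yE]]] := common_denominator (fun i => C i l).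
have [al alb] := free_hom Fb (y : 'I_n -> Zgroup).
have alE g : zchar al g = (\sum_j zchar (e j) g * y j)%R.
  have al'M g1 g2 : (\sum_j zchar (e j) (g1 * g2) * y j =
      \sum_j zchar (e j) g1 * y j + \sum_j zchar (e j) g2 * y j)%R.
    by rewrite -big_split /=; apply: eq_bigr => j _; rewrite zcharM mulrDl.
  apply: (free_ext Fb (f' := mkzchar al'M)) => i; rewrite alb /=.
  rewrite (bigD1 i) //= eE eqxx mul1r big1 ?addr0 // => j ji.
  by rewrite eE eq_sym (negbTE ji) mul0r.
have ratE g : ((zchar al g)%:~R = k%:~R * \sum_j (zchar (e j) g)%:~R * C j l :> rat)%R.
  rewrite alE rmorph_sum mulr_sumr; apply: eq_bigr => j _.
  by rewrite rmorphM /= -yE mulrCA.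
exists al; split=> [g|].
  apply: (free_ext Fb (f := comp_hom al P)) => i /=; rewrite alb.
  apply: (@intr_inj rat); rewrite [LHS]ratE -yE; congr (_ * _)%R.
  have /matrixP/(_ i l) := MC; rewrite !mxE => /eqP.
  rewrite (eq_bigr (fun j => (zchar (e j) (phi1 (b i)))%:~R * C j l -
    (i == j)%:R * C j l)%R) => [|j _]; last by rewrite !mxE mulrBl.
  rewrite sumrB subr_eq0 => /eqP->.
  by rewrite (bigD1 i) //= eqxx mul1r big1 ?addr0 // => j ji;
    rewrite eq_sym (negbTE ji) mul0r.
move=> alf; have := ratE f; rewrite alf => /esym/eqP.
rewrite mulf_eq0 intr_eq0 (negbTE k0) /= => /eqP E; apply: vl.
by rewrite mxE -[RHS]E; apply: eq_bigr => j _; rewrite mxE.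
Qed.

End InvariantCharacter.

(** * Subgroups of free groups *)

Section NielsenSchreier.
Variables (I : Type) (F K : groupType) (b : I -> F) (io : {multiplicative K -> F}).
Hypotheses (Fb : free_on b) (io_inj : injective io).
Local Notation letter := (eval_letter b).

(** A path of length [n], possibly with backtracking, leads from the base vertex to the coset of [f]
    in the Schreier graph of the left cosets of [io K]. *)
Fixpoint within (n : nat) (f : F) : Prop :=
  if n is n'.+1 then exists l, within n' ((letter l)^-1 * f) else range io f.

Lemma withinM n f k : within n (f * io k) <-> within n f.
Proof.
elim: n f => [|n IH] f /=; last first.
  by split=> -[l]; [rewrite mulgA IH|rewrite -(IH (_ * f)) -mulgA]; exists l.
split=> -[k' _ E]; last by exists (k' * k); rewrite ?homM ?E.
by exists (k' * k^-1); rewrite // homM homV E mulgK.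
Qed.

Lemma within_exists f : exists n, within n f.
Proof.
have [w ->] : exists w, f = eval_word b w.
  apply: (free_ind Fb (A := [set f | exists w, f = eval_word b w])).
    split=> [|_ _ [v ->] [w ->]|_ [w ->]]; first by exists [::].
      by exists (v ++ w); rewrite eval_cat.
    by exists (inv_word w); rewrite eval_inv.
  by move=> i; exists [:: (i, true)]; rewrite /= mulg1.
elim: w => [|l w [n IH]]; first by exists 0%N, 1; rewrite ?hom1.
by exists n.+1, l => /=; rewrite mulKg.
Qed.

Let exists_depth f : exists n, `[< within n f >].
Proof. by have [n nf] := within_exists f; exists n; apply/asboolP. Qed.

Definition depth f := ex_minn (exists_depth f).

Lemma within_depth f : within (depth f) f.
Proof. by rewrite /depth; case: ex_minnP => n /asboolP. Qed.

Lemma depth_min n f : within n f -> (depth f <= n)%N.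
Proof. by rewrite /depth; case: ex_minnP => m _ H /asboolP/H. Qed.

Lemma depthM f k : depth (f * io k) = depth f.
Proof.
apply/eqP; rewrite eqn_leq; apply/andP; split; apply: depth_min.
  exact/withinM/within_depth.
exact/(withinM _ _ k)/within_depth.
Qed.

(** The predicate depends only on the coset of [f], hence so does the choice. The default 1 is
    relevant only at depth 0. *)
Definition parent_letter f : F := xget 1
  [set x | (exists l, x = letter l) /\ (depth (x^-1 * f)).+1 = depth f].

Lemma parent_letterM f k : parent_letter (f * io k) = parent_letter f.
Proof.
congr xget; apply/seteqP; split=> x /= -[xl]; rewrite mulgA !depthM => E;
  by split.
Qed.

Lemma parent_letterP f : (0 < depth f)%N ->
  (exists l, parent_letter f = letter l) /\
  (depth ((parent_letter f)^-1 * f)).+1 = depth f.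
Proof.
move=> f_gt0; apply: (@xgetPex _ 1 [set x | (exists l, x = letter l) /\
  (depth (x^-1 * f)).+1 = depth f]).
have := within_depth f; case E: (depth f) f_gt0 => [//|n] _ [l fl].
exists (letter l); split; first by exists l.
apply/eqP; rewrite eqSS eqn_leq depth_min //= -ltnS -E; apply: depth_min.
by exists l; apply: within_depth.
Qed.

Fixpoint climb n f : F :=
  if n is n'.+1 then parent_letter f * climb n' ((parent_letter f)^-1 * f) else 1.

(* A transversal of [F / io K] closed under removal of the first letter. *)
Definition transversal f := climb (depth f) f.
Local Notation tv := transversal.

Lemma transversalM f k : tv (f * io k) = tv f.
Proof.
rewrite /transversal depthM; move: (depth f) => n; elim: n f => //= n IH f.
by rewrite parent_letterM mulgA IH.
Qed.

Lemma transversal_parent f : (0 < depth f)%N ->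
  tv f = parent_letter f * tv ((parent_letter f)^-1 * f).
Proof. by move=> /parent_letterP[_ E]; rewrite /transversal -{1}E. Qed.

Lemma transversal_coset f : exists k, tv f = f * io k.
Proof.
rewrite /transversal; move E: (depth f) => n; elim: n f E => [|n IH] f E /=.
  have := within_depth f; rewrite E => -[k _ <-].
  by exists k^-1; rewrite homV mulgV.
have [|_] := @parent_letterP f; first by rewrite E.
rewrite E => -[/IH[k ->]]; exists k.
by rewrite mulgA mulVKg.
Qed.

Lemma transversal_idem f : tv (tv f) = tv f.
Proof. by have [k E] := transversal_coset f; rewrite {1}E transversalM. Qed.

Lemma transversal_base k : tv (io k) = 1.
Proof.
have : (depth (io k) <= 0)%N by apply: depth_min; exists k.
by rewrite leqn0 /transversal => /eqP->.
Qed.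

Lemma transversal1 : tv 1 = 1.
Proof. by rewrite -{1}(hom1 io) transversal_base. Qed.

Lemma schreier_exists i f : exists k, io k = (tv (b i * f))^-1 * b i * tv f.
Proof.
have [k ->] := transversal_coset f; have [k' ->] := transversal_coset (b i * f).
by exists (k'^-1 * k); rewrite homM homV !gnorm.
Qed.

Definition schreier i f : K := sval (cid (schreier_exists i f)).

Lemma schreierE i f : io (schreier i f) = (tv (b i * f))^-1 * b i * tv f.
Proof. by rewrite /schreier; case: cid. Qed.

Lemma schreier_transversal i f : schreier i (tv f) = schreier i f.
Proof.
apply: io_inj; rewrite !schreierE transversal_idem.
by have [k {1}->] := transversal_coset f; rewrite mulgA transversalM.
Qed.

Definition schreier_index : Type :=
  {p : I * F | tv p.2 = p.2 /\ schreier p.1 p.2 <> 1}.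
Definition schreier_basis (p : schreier_index) : K :=
  schreier (sval p).1 (sval p).2.

(** The elements [(tv (g * x))^-1 * g * tv x] compose like arrows, so they are products of Schreier
    generators and their inverses; for [g = io k] and [x = 1] this element is [io k] itself. *)
Lemma schreier_generates (S : set K) : subgroup S ->
  (forall p, S (schreier_basis p)) -> forall k, S k.
Proof.
move=> [S1 SM SV] Sp.
have Sb i f : S (schreier i f).
  rewrite -schreier_transversal; have [->//|ne] := pselect (schreier i (tv f) = 1).
  exact: (Sp (exist _ (i, tv f) (conj (transversal_idem f) ne))).
have Q g : forall x, exists2 s, S s & io s = (tv (g * x))^-1 * g * tv x.
  move: g; apply: (free_ind Fb
    (A := [set g | forall x, exists2 s, S s & io s = (tv (g * x))^-1 * g * tv x])).
    split=> [x|g f /= Qg Qf x|f /= Qf x].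
    - by exists 1; rewrite // hom1 mul1g mulg1 mulVg.
    - have [s Ss sE] := Qf x; have [s' Ss' s'E] := Qg (f * x).
      by exists (s' * s); [exact: SM|rewrite homM sE s'E !gnorm].
    - have [s Ss sE] := Qf (f^-1 * x); exists s^-1; first exact: SV.
      by rewrite homV sE mulVKg !gnorm.
  by move=> i x; exists (schreier i x); rewrite ?schreierE.
move=> k; have [s Ss] := Q (io k) 1.
by rewrite transversal1 !mulg1 transversal_base invg1 mul1g => /io_inj<-.
Qed.

(* A homomorphism on [K] is the restriction of the cocycle on [F] which takes
   the prescribed values on the edges [(i, f)] of the Schreier graph outside the
   spanning tree of [tv] and is trivial on the tree. *)
Theorem nielsen_schreier : free_on schreier_basis.
Proof.
move=> A h.
pose v0 i y : A := match pselect (tv y = y /\ schreier i y <> 1) with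
  | left yP => h (exist _ (i, y) yP)
  | right _ => 1
  end.
pose v i f := v0 i (tv f).
have v1 i f : schreier i f = 1 -> v i f = 1.
  rewrite /v /v0 => sif; case: pselect => // yP.
  by exfalso; case: yP => _; rewrite schreier_transversal.
have vM i f k : v i (f * io k) = v i f by rewrite /v transversalM.
have vtv i f : v i (tv f) = v i f by rewrite /v transversal_idem.
have [H Hb] := free_hom Fb (fun i => (v i, b i) : wreath A F).
have H2 g : (H g).2 = g.
  apply: (free_ext Fb (f := comp_hom (wr_snd A F) H) (f' := idfun)) => i /=.
  by rewrite Hb.
pose c g x := (H g).1 x.
have cM g f x : c (g * f) x = c g (f * x) * c f x by rewrite /c homM wrM1 H2.
have cV g x : c g^-1 x = (c g (g^-1 * x))^-1 by rewrite /c homV wrV1 H2.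
have cb i x : c (b i) x = v i x by rewrite /c Hb.
have cK g x k : c g (x * io k) = c g x.
  move: g x; apply: (free_ind Fb (A := [set g | forall x, c g (x * io k) = c g x])).
    split=> [x|g f /= Qg Qf x|f /= Qf x]; first by rewrite /c hom1.
      by rewrite !cM mulgA Qg Qf.
    by rewrite !cV mulgA Qf.
  by move=> i x; rewrite !cb vM.
(* The word of [tv f] runs inside the spanning tree, where all Schreier elements and hence all
   values of [v] are trivial. *)
have ctv f : c (tv f) 1 = 1.
  move E: (depth f) => n; elim: n f E => [|n IH] f E.
    by rewrite /transversal E /= /c hom1.
  have [|[l pl]] := @parent_letterP f; first by rewrite E.
  have := @transversal_parent f; rewrite E => /(_ isT).
  rewrite pl; set f' := _ * f => tvf [f'E].
  rewrite tvf cM (IH _ f'E) !mulg1; case: l @f' pl tvf f'E => i [] f' pl tvf _.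
    rewrite cb vtv v1 //; apply: io_inj.
    by rewrite schreierE hom1 /f' mulVKg tvf -mulgA mulVg.
  have f'f : f' = b i * f by rewrite /f' invgK.
  rewrite -[letter _]/((b i)^-1) in tvf *.
  rewrite cV -tvf cb vtv v1 ?invg1 //; apply: io_inj.
  by rewrite schreierE hom1 -f'f tvf -mulgA mulVKg mulVg.
(* By [cK] the cocycle depends on its point only through the coset, and [io K] fixes the base coset;
   hence it is multiplicative on [K]. *)
have kM : {morph (fun k => c (io k) 1) : x y / x * y}.
  by move=> x y; rewrite homM cM mulg1 -[io y]mul1g cK.
have kb p : c (io (schreier_basis p)) 1 = h p.
  rewrite /schreier_basis; case: p => -[i f] [/= tvf ne].
  rewrite schreierE cM cM ctv !mulg1 cb vtv.
  have -> : c (tv (b i * f))^-1 (b i * tv f) = 1.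
    have E := schreierE i f.
    have {E} : (tv (b i * f))^-1 * (b i * tv f) = io (schreier i f).
      by rewrite E mulgA.
    by rewrite cV => ->; rewrite -[io _]mul1g cK ctv invg1.
  rewrite mul1g; transitivity (v0 i f); first by rewrite /v tvf.
  rewrite /v0; case: pselect => [yP|[]]; last by split.
  by rewrite (Prop_irrelevance yP (conj tvf ne)).
exists (mkhom kM); split=> [|f' f'E]; first exact: kb.
apply: (schreier_generates (subgroup_equal f' (mkhom kM))) => p.
by rewrite /= f'E -kb.
Qed.

End NielsenSchreier.

Lemma generated_finite_support (G : groupType) (E : eqType) (b : E -> G) (g : G) :
  generated (range b) g -> exists L : seq E, generated (b @` [set` L]) g.
Proof.
have mono (L L' : seq E) : {subset L <= L'} ->
    generated (b @` [set` L]) `<=` generated (b @` [set` L']).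
  move=> LL'; apply: generated_sub; first exact: subgroup_generated.
  by move=> _ [p pL <-]; apply: mem_generated; exists p => //; apply: LL'.
apply: (@generated_sub _ _
  [set g | exists L : seq E, generated (b @` [set` L]) g]).
  split=> [|x y [L Lx] [L' L'y]|x [L Lx]].
  - by exists [::]; apply: generated1.
  - exists (L ++ L'); apply: generatedM.
      by apply: mono Lx => p; rewrite mem_cat => ->.
    by apply: mono L'y => p; rewrite mem_cat => ->; rewrite orbT.
  - by exists L; apply: generatedV.
by move=> _ [p _ <-]; exists [:: p]; apply: mem_generated; exists p => //=; rewrite inE.
Qed.

(** Finitely many basis elements already generate [K]. A basis element outside this list would be
    killed by its own dual character, so the list exhausts the basis. *)
Lemma free_fg_finite_rank (E : Type) (K : groupType) (b : E -> K) (s : seq K) :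
  free_on b -> (forall k, generated [set` s] k) -> free_of_finite_rank K.
Proof.
move=> Kb sK; pose E' := {classic E}; pose b' : E' -> K := b.
have {}Kb : free_on b' by [].
have rangeK k : generated (range b') k.
  by apply: (free_ind Kb (subgroup_generated _)) => i; apply: mem_generated; exists i.
have [L sL] : exists L : seq E', forall x, x \in s -> generated (b' @` [set` L]) x.
  elim: s {sK} => [|x s [L IH]]; first by exists [::].
  have [L' xL'] := generated_finite_support (rangeK x).
  exists (L' ++ L) => y; rewrite inE => /orP[/eqP->|/IH]; [move: xL'|];
    apply: generated_sub (subgroup_generated _) _ _ => _ [p pL <-];
    by apply: mem_generated; exists p => //=; rewrite mem_cat pL ?orbT.
have LK k : generated (b' @` [set` L]) k.
  by apply: generated_sub (subgroup_generated _) _ _ (sK k) => x xs; apply: sL.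
have {rangeK} EL (p : E') : p \in L.
  have [f fE] := free_hom Kb (fun q : E' => (q == p : int) : Zgroup).
  apply: contraT => pL; have : f (b' p) = 1.
    apply: (generated_sub (subgroup_equal f (triv_hom K Zgroup)) _ (LK (b' p))).
    move=> _ [q qL <-] /=; rewrite fE; case: eqP => // qp.
    by move: pL; rewrite -qp qL.
  by rewrite fE eqxx.
pose M := undup L; have EM p : p \in M by rewrite mem_undup.
have Mi p : (index p M < size M)%N by rewrite index_mem.
exists (size M), (fun i => b' (tnth (in_tuple M) i)) => H h.
have [f [fE fU]] := Kb H (fun p => h (Ordinal (Mi p))).
have nthM p : tnth (in_tuple M) (Ordinal (Mi p)) = p.
  by rewrite (tnth_nth p) /= nth_index.
exists f; split=> [i|f' f'E]; last by apply: fU => p; rewrite -f'E nthM.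
rewrite fE; congr h; apply/val_inj => /=.
by rewrite (tnth_nth (tnth (in_tuple M) i)) /= index_uniq ?undup_uniq.
Qed.

(** * Kernels and semidirect decompositions *)

Section Kernel.
Variables (G : groupType) (psi : {multiplicative G -> Zgroup}).

Definition kernel : Type := {g : G | zchar psi g = 0%R}.
HB.instance Definition _ := gen_eqMixin kernel.
HB.instance Definition _ := gen_choiceMixin kernel.
Implicit Types x y : kernel.

Fact kernel_eq x y : sval x = sval y -> x = y.
Proof.
case: x y => [g gK] [h hK] /= E; case: h / E hK => hK.
by rewrite (Prop_irrelevance gK hK).
Qed.

Fact ker_mul_subproof x y : zchar psi (sval x * sval y) = 0%R.
Proof. by rewrite zcharM (svalP x) (svalP y). Qed.
Fact ker_inv_subproof x : zchar psi (sval x)^-1 = 0%R.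
Proof. by rewrite zcharV (svalP x). Qed.

Definition ker_mul x y : kernel := exist _ _ (ker_mul_subproof x y).
Definition ker_one : kernel := exist _ _ (zchar1 psi).
Definition ker_inv x : kernel := exist _ _ (ker_inv_subproof x).

Fact ker_mulA : associative ker_mul.
Proof. by move=> x y z; apply: kernel_eq; rewrite /= mulgA. Qed.
Fact ker_mul1 : left_id ker_one ker_mul.
Proof. by move=> x; apply: kernel_eq; rewrite /= mul1g. Qed.
Fact ker_mul1r : right_id ker_one ker_mul.
Proof. by move=> x; apply: kernel_eq; rewrite /= mulg1. Qed.
Fact ker_mulV : left_inverse ker_one ker_inv ker_mul.
Proof. by move=> x; apply: kernel_eq; rewrite /= mulVg. Qed.
Fact ker_mulVr : right_inverse ker_one ker_inv ker_mul.
Proof. by move=> x; apply: kernel_eq; rewrite /= mulgV. Qed.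

HB.instance Definition _ :=
  isGroup.Build kernel ker_mulA ker_mul1 ker_mul1r ker_mulV ker_mulVr.

Definition ker_incl : {multiplicative kernel -> G} :=
  mkhom (f := fun x : kernel => sval x) (fun _ _ => erefl).

Lemma ker_generated : fg_ker psi ->
  exists s : seq kernel, forall k, generated [set` s] k.
Proof.
case=> s [s0 sK].
have [s' s'E] : exists s' : seq kernel, s = map ker_incl s'.
  elim: s s0 {sK} => [|g s IH] s0; first by exists [::].
  have [|s' ->] := IH; first by move=> x xs; apply: s0; rewrite inE xs orbT.
  by exists (exist _ g (s0 g (mem_head _ _)) :: s').
exists s' => k; have := sK _ (svalP k).
have [S1 SM SV] := subgroup_generated [set` s'].
suff im g : generated [set` s] g ->
    exists2 x : kernel, generated [set` s'] x & sval x = g.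
  by move=> /im[x xs /kernel_eq<-].
apply: (@generated_sub _ _
  [set g | exists2 x : kernel, generated [set` s'] x & sval x = g]).
  split=> [|_ _ [x Sx <-] [y Sy <-]|_ [x Sx <-]].
  - by exists 1.
  - by exists (x * y); [apply: SM|].
  - by exists x^-1; [apply: SV|].
move=> g' /=; rewrite s'E => /mapP[x xs ->].
by exists x => //; apply: mem_generated.
Qed.

(* The lift of the identity of [G] to the free group on the set [G] restricts,
   at the vertex [0], to a section of [free_group G -> G] over the kernel. *)
Lemma kernel_free : liftable psi -> fg_ker psi -> free_of_finite_rank kernel.
Proof.
move=> lift /ker_generated[s sK].
have [p pE] := free_hom (@free_group_free G) (id : G -> G).
have [g|h hP] := lift G (free_group G) p idfun; first by exists (fg_gen g).
have h2 g : (h g).2 = psi g by case: (hP g).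
pose io (k : kernel) := (h (sval k)).1 (0%R : Zgroup).
have ioM : {morph io : x y / x * y}.
  move=> x y; rewrite /io [sval _]/(sval x * sval y) (cocycleM h2) (svalP y).
  by rewrite addr0.
have io_inj : injective (mkhom ioM).
  move=> x y E; apply: kernel_eq.
  rewrite -[LHS](proj2 (hP (sval x)) (0%R : Zgroup)).
  by rewrite -[RHS](proj2 (hP (sval y)) (0%R : Zgroup)); congr (p _).
pose Kfree := @nielsen_schreier _ _ _ _ _ (@free_group_free G) io_inj.
exact: (free_fg_finite_rank Kfree sK).
Qed.

(** The image of [psi] consists of the multiples of its least positive value [d], and [q] is the
    quotient of [psi] by [d]. *)
Lemma image_generator : (exists g, zchar psi g <> 0%R) ->
  exists (q : {multiplicative G -> Zgroup}) (d : int) t,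
    [/\ d <> 0%R, zchar q t = 1%R & forall g, zchar psi g = (zchar q g * d)%R].
Proof.
case=> g0 g0E.
have ex : exists n : nat, `[< (0 < n)%N /\ exists g, zchar psi g = Posz n >].
  exists `|zchar psi g0|%N; apply/asboolP; split; first lia.
  have [pos|neg] := lerP 0%R (zchar psi g0); first by exists g0; lia.
  by exists g0^-1; rewrite zcharV; lia.
case: (ex_minnP ex) => d /asboolP[d_gt0 [t td]] d_min {ex}.
have dvd g : (Posz d %| zchar psi g)%Z.
  rewrite dvdz_eq; apply/eqP; set x := zchar psi g.
  have E := divz_eq x (Posz d).
  have r_ge0 : (0 <= (x %% Posz d)%Z)%R by apply: modz_ge0; lia.
  have r_lt : ((x %% Posz d)%Z < Posz d)%R by apply: ltz_pmod; lia.
  have [r0|r_gt0] := eqVneq (x %% Posz d)%Z 0%R; first by rewrite {2}E r0 addr0.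
  suff : (d <= `|(x %% Posz d)%Z|)%N by lia.
  apply: d_min; apply/asboolP; split; first lia.
  exists (g * zpow t (- (x %/ Posz d)%Z)%R).
  by rewrite zcharM zchar_zpow td -/x; lia.
have qM f g : (zchar psi (f * g) %/ Posz d)%Z =
    ((zchar psi f %/ Posz d)%Z + (zchar psi g %/ Posz d)%Z)%R.
  by rewrite zcharM divzDl.
exists (mkzchar qM), (Posz d), t; split=> [|| g].
- lia.
- rewrite -[LHS]/((zchar psi t) %/ Posz d)%Z td divzz.
  by case: eqP => [|_]; first lia.
- by rewrite [zchar (mkzchar qM) g]/((zchar psi g) %/ Posz d)%Z (divzK (dvd g)).
Qed.

(** The normalized character [q] has the same kernel and is split by the powers of [t], which act on
    the kernel by conjugation. *)
Lemma free_by_cyclic_of_kernel : (exists g, zchar psi g <> 0%R) ->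
  free_of_finite_rank kernel -> free_by_cyclic G.
Proof.
move=> /image_generator[q [d [t [d0 qt psiE]]]] Kfree; exists kernel; split=> //.
have kerP g : zchar q g = 0%R -> zchar psi g = 0%R.
  by rewrite psiE => ->; rewrite mul0r.
have conj_ker k (x : kernel) : zchar psi (zpow t k * sval x * (zpow t k)^-1) = 0%R.
  by rewrite !zcharM zcharV (svalP x); lia.
pose a k (x : kernel) : kernel := exist _ _ (conj_ker k x).
have a1 x : a (1 : Zgroup) x = x.
  by apply: kernel_eq; rewrite /= !gnorm.
have aM (k l : Zgroup) x : a (k * l) x = a k (a l x).
  by apply: kernel_eq; rewrite /= zpowD !gnorm.
have am k x y : a k (x * y) = a k x * a k y.
  by apply: kernel_eq; rewrite /= !gnorm.
pose phi := @GroupAction Zgroup kernel a a1 aM am.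
exists phi.
have redP g : zchar psi (g * (zpow t (zchar q g))^-1) = 0%R.
  by apply: kerP; rewrite zcharM zcharV zchar_zpow qt mulr1 subrr.
pose th g : sdprod phi := (exist _ _ (redP g) : kernel, zchar q g : Zgroup).
have thM : {morph th : g h / g * h}.
  move=> g h; rewrite /th [RHS]/mul /= /sd_mul /=; congr pair; last exact: zcharM.
  by apply: kernel_eq; rewrite /= zcharM zpowD !gnorm.
exists (mkhom thM).
exists (fun x : sdprod phi => sval x.1 * zpow t x.2) => [g|[x k]] /=.
  by rewrite mulgVK.
have qx : zchar q (sval x) = 0%R.
  by have := svalP x; rewrite psiE => /eqP; rewrite mulf_eq0 => /orP[/eqP//|/eqP/d0].
have qE : zchar q (sval x * zpow t k) = k.
  by rewrite zcharM qx zchar_zpow qt mulr1 add0r.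
rewrite /th; congr pair => //; apply: kernel_eq.
by rewrite /= qE mulgK.
Qed.

End Kernel.

(** * Amalgamating characters *)

Section Scaling.
Variables (G : groupType) (psi : {multiplicative G -> Zgroup}) (m : int).

Fact scale_charM x y :
  (m * zchar psi (x * y) = m * zchar psi x + m * zchar psi y)%R.
Proof. by rewrite zcharM mulrDr. Qed.

Definition scale_char : {multiplicative G -> Zgroup} := mkzchar scale_charM.

Lemma scale_fg_ker : m <> 0%R -> fg_ker psi -> fg_ker scale_char.
Proof.
move=> m0 [s [s0 sK]]; exists s; split=> [x /s0 x0|g].
  by rewrite /zchar /= x0 mulr0.
rewrite -[zchar _ g]/(m * zchar psi g)%R => /eqP.
by rewrite mulf_eq0 => /orP[/eqP/m0//|/eqP]; apply: sK.
Qed.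

Lemma scale_liftable : m <> 0%R -> liftable psi -> liftable scale_char.
Proof.
move=> m0 lift A A' p u p_surj; have [h hP] := lift A A' p u p_surj.
have h2 g : (h g).2 = psi g by case: (hP g).
(* Each residue class modulo [m] is preserved by the scaled action and carries a copy of the old
   cocycle. *)
pose h' g : wreath A' Zgroup :=
  (fun x : Zgroup => (h g).1 (x %/ m)%Z, (m * zchar psi g)%R).
have hM : {morph h' : x y / x * y}.
  move=> x y; apply: wr_eq => [k|]; last exact: scale_charM.
  rewrite wrM1 /= (cocycleM h2); congr (_ * _); congr ((h x).1 _).
  by rewrite -[(_ * k : Zgroup)]/(m * zchar psi y + k)%R mulrC divzMDl //; apply/eqP.
exists (mkhom hM) => g; split=> // x; exact: (hP g).2.
Qed.

End Scaling.

Section AmalgamLift.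
Variables (G0 G1 G2 G : groupType).
Variables (f1 : {multiplicative G0 -> G1}) (f2 : {multiplicative G0 -> G2}).
Variables (j1 : {multiplicative G1 -> G}) (j2 : {multiplicative G2 -> G}).
Hypothesis GA : is_amalgam f1 f2 j1 j2.

(* Lifts on [G1] and [G2] differ on [G0] by a coboundary with values in the
   kernel of [p], because [G0] acts freely on the integers. *)
Lemma amalgam_liftable (psi : {multiplicative G -> Zgroup}) (z : G0) :
    generated [set z] = setT -> zchar psi (j1 (f1 z)) <> 0%R ->
    liftable (comp_hom psi j1) -> liftable (comp_hom psi j2) ->
  liftable psi.
Proof.
move=> zT psiz L1 L2 A A' p u p_surj.
set d := zchar psi (j1 (f1 z)) in psiz.
have [h1 h1P] := L1 A A' p (comp_hom u j1) p_surj.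
have [h2 h2P] := L2 A A' p (comp_hom u j2) p_surj.
have h12 g : (h1 g).2 = comp_hom psi j1 g by case: (h1P g).
have h22 g : (h2 g).2 = comp_hom psi j2 g by case: (h2P g).
pose c1 q x := (h1 (f1 (zpow z q))).1 x.
pose c2 q x := (h2 (f2 (zpow z q))).1 x.
have c1S q (x : int) : c1 (1 + q)%R x = (h1 (f1 z)).1 (q * d + x)%R * c1 q x.
  rewrite /c1 zpow_succ homM (cocycleM h12).
  by rewrite hom_zpow zchar_zpow.
have c2S q (x : int) : c2 (1 + q)%R x = (h2 (f2 z)).1 (q * d + x)%R * c2 q x.
  rewrite /c2 zpow_succ homM (cocycleM h22) hom_zpow zchar_zpow.
  by rewrite [zchar (comp_hom psi j2) _]/(zchar psi (j2 (f2 z))) -GA.1.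
(* Every orbit of [G0] on the integers is free with a unique point [x %% d]; setting [be] to 1 there
   and transporting it along the two cocycles gives the coboundary relation [beS]. *)
pose be (x : Zgroup) := c1 (x %/ d)%Z (x %% d)%Z * (c2 (x %/ d)%Z (x %% d)%Z)^-1.
have beS (x : int) : be (d + x)%R = (h1 (f1 z)).1 x * be x * ((h2 (f2 z)).1 x)^-1.
  have d0 : (d != 0)%R by apply/eqP.
  rewrite /be modzDl divzDl ?dvdzz // divzz d0 c1S c2S -divz_eq.
  by rewrite !gnorm.
have pbe x : p (be x) = 1.
  by rewrite homM homV (proj2 (h1P _)) (proj2 (h2P _)) /= GA.1 mulgV.
move: be beS pbe => be beS pbe.
have [x|h [hE1 hE2 _]] := GA.2 _ h1 (twist_hom be h2).
  have : (comp_hom h1 f1) x = (comp_hom (twist_hom be h2) f2) x; last by [].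
  have : generated [set z] x by rewrite zT.
  apply: (generated_sub (subgroup_equal _ _)) => _ -> /=.
  apply: wr_eq => [y|] /=; last by rewrite h12 h22 /= GA.1.
  rewrite h22 (_ : comp_hom psi j2 (f2 z) = d); last by rewrite /d GA.1.
  by rewrite -[((d : Zgroup) * y)]/(d + y)%R beS !gnorm.
have hpsi g : (h g).2 = psi g.
  apply: (amalgam_ind GA (subgroup_equal (comp_hom (wr_snd _ _) h) psi)) => y /=.
    by rewrite hE1 h12.
  by rewrite hE2 /= h22.
exists h => g; split; [exact: hpsi|move: g].
apply: (amalgam_ind GA (subgroupoid_full (subgroupoid_lift hpsi p u))) => g x.
  by rewrite hE1; case: (h1P g) => _ ->.
by rewrite hE2 /= !homM homV !pbe (proj2 (h2P _)) mul1g invg1 mulg1.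
Qed.

End AmalgamLift.

(** * Separating characters and sufficiency of the conditions *)

(** Invariance lets [al] extend to the semidirect product with any value [N] at [t]; taking [N]
    larger than the supports of both conjugation maps brings it close to the fibration. *)
Lemma fibration_character (F : groupType) n (b : 'I_n -> F)
    (phi : group_action Zgroup F) (al : {multiplicative F -> Zgroup}) :
    free_on b -> (forall f, zchar al (phi 1%Z f) = zchar al f) ->
  exists psi : {multiplicative sdprod phi -> Zgroup},
    [/\ exists2 N : int, (0 < N)%R &
          forall x, zchar psi x = (zchar al x.1 + x.2 * N)%R,
        liftable psi & fg_ker psi].
Proof.
move=> Fb al_inv.
have [B1 B1P] := supported_family al (fun i => phi 1%Z (b i)) Fb.
have [B2 B2P] := supported_family al (fun i => phi (-1)%Z (b i)) Fb.
pose N : int := (1 + Posz (B1 + B2))%R.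
have rel f : (N : Zgroup) * al f = al (phi 1%Z f) * (N : Zgroup).
  by rewrite -[RHS]/(zchar al (phi 1%Z f) + N)%R al_inv addrC.
have [psi psiE] := sd_hom rel.
have psiE' x : zchar psi x = (zchar al x.1 + x.2 * N)%R.
  rewrite /zchar psiE; congr (_ + _)%R.
  exact: (zchar_zpow (idfun : {multiplicative Zgroup -> Zgroup}) (N : Zgroup) x.2).
have supp B f : supported b al B f ->
    supported b (comp_hom psi (sd_inl_hom phi)) B f.
  move=> fB Q [Q1 QM QV]; apply: fB.
  have E g : zchar (comp_hom psi (sd_inl_hom phi)) g = zchar al g.
    by rewrite -[LHS]/(zchar psi (sd_inl phi g)) psiE' mul0r addr0.
  by split=> [//|g h x|h x]; rewrite -E; [apply: QM|apply: QV].
have supp1 i : supported b (comp_hom psi (sd_inl_hom phi)) (B1 + B2) (phi 1%Z (b i)).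
  by apply: supp; apply: supportedW (B1P i); apply: leq_addr.
have supp2 i : supported b (comp_hom psi (sd_inl_hom phi)) (B1 + B2) (phi (-1)%Z (b i)).
  by apply: supp; apply: supportedW (B2P i); apply: leq_addl.
have BN : (Posz (B1 + B2) < zchar psi (sd_t phi))%R.
  by rewrite psiE' /= zchar1 add0r mul1r /N; lia.
exists psi; split; first by exists N; rewrite // /N; lia.
- exact: (fibration_liftable Fb supp1 supp2 BN).
- exact: (fibration_fg_ker Fb supp1 supp2 BN).
Qed.

(** If [w] lies in the fibre, an invariant character nonzero at [w] is extended; otherwise a
    multiple of the fibration itself, with [al] trivial, is nonzero at [w]. *)
Lemma separating_character (G : groupType) (w : G) : free_by_cyclic G ->
    (forall k, commutator_subgroup G (zpow w k) -> k = 0%R) ->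
  exists psi : {multiplicative G -> Zgroup},
    [/\ zchar psi w <> 0%R, liftable psi & fg_ker psi].
Proof.
case=> F [[n [b Fb]] [phi [th [th' thK th'K]]]] wD.
pose th'h := mkhom (can2_gmulfM thK th'K).
have [psi [psiw lift [s [s0 sK]]]] :
    exists psi : {multiplicative sdprod phi -> Zgroup},
      [/\ zchar psi (th w) <> 0%R, liftable psi & fg_ker psi].
  have {wD} : forall k, commutator_subgroup _ (zpow (th w) k) -> k = 0%R.
    move=> k /(hom_commutators th'h); rewrite hom_zpow /= thK; exact: wD.
  case: (th w) => f k wD; have [k0|k0] := eqVneq k 0%R.
    have [|al [al_inv alf]] := @invariant_character _ _ _ phi Fb f.
      by move: wD; rewrite k0.
    have [psi [[N N0 psiE] lift K]] := fibration_character Fb al_inv.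
    by exists psi; split=> //; rewrite psiE k0 mul0r addr0.
  have [] := @fibration_character _ _ _ phi (triv_hom F Zgroup) Fb.
    by move=> g.
  move=> psi [[N N0 psiE] lift K]; exists psi; split=> //.
  rewrite psiE /= add0r => /eqP; rewrite mulf_eq0 (negbTE k0) /=.
  by move/eqP; lia.
exists (comp_hom psi th); split=> //.
  move=> A A' p u p_surj.
  have [h hP] := lift A A' p (comp_hom u th'h) p_surj.
  by exists (comp_hom h th) => g; have [E1 E2] := hP (th g);
    split=> //= x; rewrite E2 /= thK.
exists (map th' s); split=> [_ /mapP[x xs ->]|g g0].
  by rewrite /zchar /= th'K; apply: s0.
rewrite -[g]thK; apply: (@generated_sub _ _
  (th'h @^-1` generated [set` map th' s]) _ _ _ (sK (th g) g0)).
  exact/subgroup_preim/subgroup_generated.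
by move=> x xs; apply: mem_generated => /=; apply: map_f.
Qed.

Lemma amalgam_free_by_cyclic (G0 G1 G2 G : groupType)
    (f1 : {multiplicative G0 -> G1}) (f2 : {multiplicative G0 -> G2})
    (j1 : {multiplicative G1 -> G}) (j2 : {multiplicative G2 -> G})
    (psi1 : {multiplicative G1 -> Zgroup}) (psi2 : {multiplicative G2 -> Zgroup})
    (z : G0) :
    is_amalgam f1 f2 j1 j2 -> generated [set z] = setT ->
    zchar psi1 (f1 z) <> 0%R -> zchar psi2 (f2 z) <> 0%R ->
    liftable psi1 -> fg_ker psi1 -> liftable psi2 -> fg_ker psi2 ->
  free_by_cyclic G.
Proof.
move=> GA zT; set a := zchar psi1 (f1 z); set b := zchar psi2 (f2 z).
move=> a0 b0 L1 K1 L2 K2.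
(* Scaling by [a b^2] and [a^2 b] makes both characters equal [(a b)^2] at [z]: they agree on [G0],
   with a positive value. *)
have m1 : (a * b ^+ 2)%R <> 0%R.
  by apply/eqP; rewrite mulf_neq0 ?expf_neq0 //; apply/eqP.
have m2 : (a ^+ 2 * b)%R <> 0%R.
  by apply/eqP; rewrite mulf_neq0 ?expf_neq0 //; apply/eqP.
have [x|psi [E1 E2 _]] := GA.2 _ (scale_char psi1 (a * b ^+ 2)%R)
                                (scale_char psi2 (a ^+ 2 * b)%R).
  have [k ->] := cyclic_zpow zT x; rewrite !hom_zpow; congr zpow.
  by rewrite /= -/a -/b; lia.
have ext (H : groupType) (p q : {multiplicative H -> Zgroup}) :
    (forall x, p x = q x) -> (liftable p -> liftable q) /\ (fg_ker p -> fg_ker q).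
  move=> E; split=> [L A A' r u r_surj|[s [s0 sK]]].
    by have [h hP] := L A A' r u r_surj; exists h => g; rewrite -E.
  by exists s; rewrite /zchar; split=> [x|g]; rewrite -E; [apply: s0|apply: sK].
have [eL1 eK1] := ext _ (scale_char psi1 (a * b ^+ 2)%R) (comp_hom psi j1)
  (fun x => esym (E1 x)).
have [eL2 eK2] := ext _ (scale_char psi2 (a ^+ 2 * b)%R) (comp_hom psi j2)
  (fun x => esym (E2 x)).
have psiz : (0 < zchar psi (j1 (f1 z)))%R.
  rewrite /zchar E1 /= -/a.
  rewrite (_ : (a * b ^+ 2 * a = (a * b) ^+ 2)%R); last lia.
  by rewrite lt_def sqr_ge0 expf_neq0 // mulf_neq0 //; apply/eqP.
have psiz0 : zchar psi (j1 (f1 z)) <> 0%R by lia.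
apply: (@free_by_cyclic_of_kernel _ psi); first by exists (j1 (f1 z)).
apply: kernel_free.
  apply: (amalgam_liftable GA zT psiz0).
    exact/eL1/scale_liftable.
  exact/eL2/scale_liftable.
apply: (amalgam_fg_ker GA psiz).
  exact/eK1/scale_fg_ker.
exact/eK2/scale_fg_ker.
Qed.

Theorem corollary1p11 (G0 G1 G2 G : groupType)
    (f1 : {multiplicative G0 -> G1}) (f2 : {multiplicative G0 -> G2})
    (j1 : {multiplicative G1 -> G}) (j2 : {multiplicative G2 -> G})
    (hG1 : free_by_cyclic G1) (hG2 : free_by_cyclic G2)
    (hG0 : is_cyclic G0)
    (f1_inj : injective f1) (f2_inj : injective f2)
    (f1_proper : range f1 <> [set: G1]) (f2_proper : range f2 <> [set: G2])
    (hG : is_amalgam f1 f2 j1 j2) :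
  free_by_cyclic G <->
    (infinite_set [set: G0] /\
     range f1 `&` commutator_subgroup G1 = [set 1] /\
     range f2 `&` commutator_subgroup G2 = [set 1]).
Proof.
have [z zT] := hG0; split=> [Gfbc|[/(infinite_order zT) zinf [C1 C2]]].
  have [xi [y xiy]] :=
    free_by_cyclic_amalgam_character hG f1_inj f2_inj f1_proper f2_proper Gfbc.
  have xiz : zchar xi (j1 (f1 z)) <> 0%R.
    move=> xi0; apply: xiy; have [k ->] := cyclic_zpow zT y.
    by rewrite !hom_zpow zchar_zpow xi0 mulr0.
  split; [|split].
  - apply/(infinite_order zT) => k zk; apply: contrapT => k0; apply: xiz.
    have := congr1 (fun x => zchar xi (j1 (f1 x))) zk.
    rewrite !hom_zpow zchar_zpow !hom1 zchar1 => /eqP.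
    by rewrite mulf_eq0 => /orP[/eqP/k0//|/eqP].
  - exact: (meets_commutators_trivially (psi := comp_hom xi j1) zT xiz).
  - apply: (meets_commutators_trivially (psi := comp_hom xi j2) zT).
    by rewrite /zchar /= -hG.1.
(* Infinite order turns the trivial intersection into the statement that no nonzero power of [f z]
   is a product of commutators. *)
have sep (H : groupType) (f : {multiplicative G0 -> H}) : injective f ->
    range f `&` commutator_subgroup H = [set 1] ->
    forall k, commutator_subgroup H (zpow (f z) k) -> k = 0%R.
  move=> f_inj C k kD; apply: zinf; apply: f_inj; rewrite hom1.
  suff : [set 1] (f (zpow z k)) by [].
  by rewrite -C hom_zpow; split=> //; exists (zpow z k); rewrite ?hom_zpow.
have [psi1 [n1 L1 K1]] := separating_character hG1 (sep _ _ f1_inj C1).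
have [psi2 [n2 L2 K2]] := separating_character hG2 (sep _ _ f2_inj C2).
exact: (amalgam_free_by_cyclic hG zT n1 n2).
Qed.
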